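(* There exists a non-measurable (with respect to Lebesgue measure) set $E\subset\mathbb R^2$ that is CNED.
   Context: Here the dimension is $n=2$. A path (or curve) in $\mathbb R^2$ is a continuous map $\gamma\colon I\to\mathbb R^2$ with $I\subset\mathbb R$ a compact interval; its trace is $|\gamma|=\gamma(I)$. For a family $\Gamma$ of curves in $\mathbb R^2$, $\mathrm{Mod}_2\Gamma=\inf_\rho\int_{\mathbb R^2}\rho^2$, the infimum over all Borel functions $\rho\colon\mathbb R^2\to[0,\infty]$ with $\int_\gamma\rho\,ds\ge1$ for every rectifiable $\gamma\in\Gamma$ ($\mathrm{Mod}_2\Gamma=\infty$ if there are none). A continuum is a compact connected set. $\Gamma(F_1,F_2;\mathbb R^2)$ is the family of curves $\gamma\colon[a,b]\to\mathbb R^2$ with $\gamma(a)\in F_1$, $\gamma(b)\in F_2$. For a set $E\subset\mathbb R^2$ (arbitrary), $\mathcal F_\sigma(E)$ is the family of curves $\gamma$ such that $E\cap|\gamma|$ is countable (finite or infinite). $E$ is CNED if $\mathrm{Mod}_2\Gamma(F_1,F_2;\mathbb R^2)=\mathrm{Mod}_2(\Gamma(F_1,F_2;\mathbb R^2)\cap\mathcal F_\sigma(E))$ for every pair of non-empty, disjoint continua $F_1,F_2\subset\mathbb R^2$. *)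

(* Defs.v *)
From mathcomp Require Import all_boot all_order all_algebra.
From mathcomp Require Import all_classical all_reals all_analysis.
From mathcomp Require Import measurable_realfun.

Set Implicit Arguments.
Unset Strict Implicit.
Unset Printing Implicit Defensive.

Import Order.TTheory GRing.Theory Num.Theory.
Import numFieldNormedType.Exports.

Local Open Scope classical_set_scope.
Local Open Scope ring_scope.

(* The norm that the library puts on R * R is the sup norm. It is used below
   only through the topology (which is the usual one); lengths of curves are
   computed with the Euclidean distance. *)
Definition edist (R : realType) (x y : R * R) : R :=
  Num.sqrt ((x.1 - y.1) ^+ 2 + (x.2 - y.2) ^+ 2).

(* The sigma-algebra on R * R is the product of the Borel sigma-algebras of R,
   that is, the Borel sigma-algebra of the plane. *)
Definition leb2 (R : realType) : set (R * R) -> \bar R :=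
  (@lebesgue_measure R \x @lebesgue_measure R)%E.

(* A set is Lebesgue measurable when it belongs to the completion of the Borel
   sigma-algebra, i.e., when it is the union of a Borel set and of a subset of
   a Borel null set. *)
Definition leb2_measurable (R : realType) (A : set (R * R)) : Prop :=
  completed_algebra_gen (@leb2 R) A.

(* The values of [cpath] outside [clo, chi] are irrelevant: no definition below
   depends on them. *)
Record curve (R : realType) : Type := Curve {
  clo : R ;
  chi : R ;
  clo_le_chi : clo <= chi ;
  cpath : R -> R * R ;
  cpath_continuous : {within `[clo, chi], continuous cpath} }.

Definition trace (R : realType) (g : curve R) : set (R * R) :=
  cpath g @` `[clo g, chi g].

(* Same conventions as [variation], [variations] and [total_variation], which
   the library only provides for real-valued functions: the points of the
   partition are a :: s. *)
Definition polygonal_length (R : realType) (a b : R) (p : R -> R * R)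
    (s : seq R) : R :=
  let F := p \o nth b (a :: s) in
  \sum_(0 <= n < size s) edist (F n.+1) (F n).

Definition path_length (R : realType) (a b : R) (p : R -> R * R) : \bar R :=
  ereal_sup [set (polygonal_length a b p s)%:E | s in itv_partition a b].

Definition curve_length (R : realType) (g : curve R) : \bar R :=
  path_length (clo g) (chi g) (cpath g).

Definition rectifiable (R : realType) (g : curve R) : Prop :=
  (curve_length g < +oo)%E.

(* Arc-length parametrization of a rectifiable curve: the value at l is the
   value of g at any parameter t at which the length of g restricted to
   [clo g, t] equals l. Such a t exists when l lies in [0, curve_length g], and
   the value does not depend on its choice, g being constant between two such
   parameters. *)
Definition arclength_param (R : realType) (g : curve R) (l : R) : R * R :=
  cpath g (xget (clo g)
    [set t | t \in `[clo g, chi g] /\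
             path_length (clo g) t (cpath g) = l%:E]).

(* The integral of rho along g with respect to arc length, meaningful for
   rectifiable g. *)
Definition line_integral (R : realType) (rho : R * R -> \bar R)
    (g : curve R) : \bar R :=
  (\int[@lebesgue_measure R]_(l in `[0%R, fine (curve_length g)])
     rho (arclength_param g l))%E.

Definition admissible (R : realType) (G : set (curve R))
    (rho : R * R -> \bar R) : Prop :=
  [/\ measurable_fun setT rho,
      forall x, (0 <= rho x)%E &
      forall g, G g -> rectifiable g -> (1 <= line_integral rho g)%E].

(* The infimum of the empty set is +oo. *)
Definition Mod2 (R : realType) (G : set (curve R)) : \bar R :=
  ereal_inf [set (\int[@leb2 R]_x (rho x ^+ 2))%E | rho in admissible G].

Definition continuum (R : realType) (F : set (R * R)) : Prop :=
  compact F /\ connected F.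

Definition joining (R : realType) (F1 F2 : set (R * R)) : set (curve R) :=
  [set g | F1 (cpath g (clo g)) /\ F2 (cpath g (chi g))].

(* [countable] allows finite sets. *)
Definition Fsigma (R : realType) (E : set (R * R)) : set (curve R) :=
  [set g | countable (E `&` trace g)].

Definition CNED (R : realType) (E : set (R * R)) : Prop :=
  forall F1 F2 : set (R * R),
    continuum F1 -> continuum F2 -> F1 !=set0 -> F2 !=set0 ->
    F1 `&` F2 = set0 ->
    Mod2 (joining F1 F2) = Mod2 (joining F1 F2 `&` Fsigma E).

(* Main.v *)
From HB Require Import structures.
From mathcomp Require Import all_boot all_order all_algebra.
From mathcomp Require Import all_classical all_reals all_analysis.
From mathcomp Require Import measurable_realfun ring lra.
From mathcomp Require wochoice.
Require Import Defs.

(** The set E is built so that every line of rational slope, horizontal and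
    vertical lines included, meets it in at most one point, while E is
    contained in no Borel null set. Such a set is not measurable: a Borel
    subset of E has sections with at most one point, so it is null by Fubini,
    and a measurable E would then be null ([sparse_nonmeasurable]). It exists
    by transfinite recursion over the Borel null sets N, of which there are
    continuum many ([borel_code]): outside N one finds a point that lies on no
    line of rational slope through the fewer than continuum many points chosen
    before, because each such line excludes one value of a coordinate, and a
    set of positive measure has too many points to be exhausted by countably
    many excluded values for each earlier point ([null_escape],
    [positive_measure_surj]).

    That E is CNED only uses that translates of polygons with rational
    vertices, and rectangles with sides parallel to the axes, meet E in
    finitely many points ([sparse_CNED]). Let rho be admissible for the curves
    that join F1 to F2 and meet E in a countable set. Averaging rho over
    squares of small side r gives a density that is admissible, up to a factor
    close to 1, for all curves joining F1 to F2 ([mollified_length]), and by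
    the Cauchy-Schwarz inequality its energy is hardly larger than that of rho
    ([integral_mollify_sqr]). Indeed, approximate a curve by a polygon with
    rational vertices. By Fubini, some translate of this polygon by a vector
    of size at most r has rho-length at most about the integral of the
    averaged density along the curve ([polygon_approximation]). The translate
    no longer starts on F1 nor ends on F2. But around each end point of the
    curve there is a rectangle of size comparable with r whose boundary has
    small rho-length ([cheap_frame]); when r is small compared with the
    diameter of F1, this boundary meets both F1 and the polygon, by
    connectedness, and an arc of it links them. The resulting curve joins F1
    to F2 and meets E in a countable set, so its rho-length is at least 1.

    This argument needs F1 and F2 to have more than one point. If one of them
    is a single point, the modulus of all the curves joining them vanishes
    ([Mod2_point]). *)

Set Implicit Arguments.
Unset Strict Implicit.
Unset Printing Implicit Defensive.
Import Order.TTheory GRing.Theory Num.Theory.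
Import numFieldNormedType.Exports.
Local Open Scope classical_set_scope.
Local Open Scope ring_scope.

(** * A sparse set that is not null *)

(** When I is nonempty, this says that the cardinality of D is less than that
    of I. *)
Definition small (I : Type) (D : set I) := forall f : I -> I, f @` D <> setT.

(** A well-order of I may have initial segments as large as I. Cutting it at
    the first such segment leaves a set W that still surjects onto I, and all of
    whose initial segments are small. The map g is kept instead of a bijection
    between W and I: it serves to index a family by W. *)
Lemma short_well_order (I : choiceType) :
  exists (lt : I -> I -> Prop) (W : set I) (g : I -> I),
    [/\ well_founded lt, forall v w, [\/ lt v w, v = w | lt w v],
     forall w, W w -> small [set v | W v /\ lt v w] & g @` W = setT].
Proof.
have [r r_wo] := wochoice.well_ordering_principle I.
pose lt v w : Prop := r v w /\ v <> w.
have rmin (A : set I) : A !=set0 -> exists2 z, A z & forall x, A x -> r z x.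
  move=> [x Ax]; have [|z [[zA zmin] _]] := r_wo (mem A).
    by exists x; rewrite inE.
  exists z; first by move: zA; rewrite inE.
  by move=> y Ay; apply: zmin; rewrite inE.
have rtot v w : r v w \/ r w v.
  have [|z zA zmin] := rmin [set v; w]; first by exists v; left.
  by case: zA zmin => -> zmin; [left|right]; apply: zmin; [right|left].
have rasym v w : r v w -> r w v -> v = w.
  move=> vw wv; have [|z [_ zuniq]] := r_wo (mem [set v; w]).
    by exists v; rewrite inE; left.
  have rr x : r x x by case: (rtot x x).
  rewrite -(zuniq v); last first.
    by split=> [|x]; rewrite inE; [left|case=> ->].
  by apply: zuniq; split=> [|x]; rewrite inE; [right|case=> ->].
have lt_wf : well_founded lt.
  move=> a; apply: contrapT => /= na.
  have [|z zA zmin] := rmin [set x | ~ Acc lt x]; first by exists a.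
  apply: zA; constructor=> y [yz ynz]; apply: contrapT => nAy.
  exact/ynz/rasym/zmin.
have lt_tri v w : [\/ lt v w, v = w | lt w v].
  have [<-|vw] := pselect (v = w); first exact: Or32.
  by case: (rtot v w) => h; [apply: Or31|apply: Or33]; split=> // /esym.
have [[w0 w0bad]|nobad] := pselect (exists w, ~ small [set v | lt v w]).
  have [|w wbad wmin] := rmin [set w | ~ small [set v | lt v w]].
    by exists w0.
  have /existsNP[g /contrapT gT] := wbad.
  exists lt, [set v | lt v w], g; split=> // v /= [vw vnw] f fT.
  apply: (vnw); apply: rasym => //; apply: wmin => /= /(_ f); apply.
  apply/seteqP; split=> // x _; have : [set: I] x by [].
  by rewrite -fT => -[y [_ yv] <-]; exists y.
exists lt, setT, id; split=> //; last by rewrite image_id.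
move=> w _ f fT; apply: nobad; exists w => /(_ f); apply.
by rewrite -fT; congr (f @` _); apply/seteqP; split=> x //= -[].
Qed.

(** Recursion along lt, for a condition on the new value that only depends on
    the set of the earlier values. *)
Lemma transfinite_choice (I : Type) (X : pointedType) (lt : I -> I -> Prop)
    (W : set I) (Q : I -> set X -> X -> Prop) :
  well_founded lt ->
  (forall w (x : I -> X), W w ->
     exists y, Q w (x @` [set v | W v /\ lt v w]) y) ->
  exists x : I -> X, forall w, W w ->
     Q w (x @` [set v | W v /\ lt v w]) (x w).
Proof.
move=> lt_wf Qex.
pose F w (rec : forall v, lt v w -> X) :=
  xget point (Q w [set y | exists v (h : lt v w), W v /\ rec v h = y]).
pose x := Fix lt_wf (fun=> X) F.
have xE w : x w = F w (fun v _ => x v).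
  rewrite /x Fix_eq//= => v f g fg; congr F.
  by apply: functional_extensionality_dep => u; apply/funext => h.
exists x => w Ww; rewrite [x w]xE /F.
rewrite (_ : [set y | _] = x @` [set v | W v /\ lt v w]).
  by have [y Qy] := Qex w x Ww; exact: (xgetI point Qy).
apply/seteqP; split=> y /=.
  by move=> [v [h [Wv <-]]]; exists v.
by move=> [v [Wv h] <-]; exists v, h.
Qed.

(** Koenig's diagonal argument: when I surjects onto the sequences of elements
    of I, the n-th term of the sequence is chosen so as to escape the image of
    D under the n-th map. It is the only cardinal arithmetic in the
    construction. *)
Lemma small_bigcup (I : Type) (pi : I -> nat -> I) (D : set I)
    (f : nat -> I -> I) :
  pi @` setT = setT -> small D -> exists t, forall n i, D i -> f n i <> t.
Proof.
move=> piT sD.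
have /choice[y yP] n : exists y, forall i, D i -> pi (f n i) n <> y.
  apply: contrapT => /forallNP H; apply: (sD (fun i => pi (f n i) n)).
  apply/seteqP; split=> // y _; have /existsNP[i] := H y.
  by move=> /not_implyP[Di /contrapT <-]; exists i.
have : [set: nat -> I] y by [].
rewrite -piT => -[t _ ty]; exists t => n i Di ft.
by apply: (yP n i Di); rewrite ft ty.
Qed.

Notation bits := (nat -> bool).

Lemma bits_power : exists pi : bits -> nat -> bits, pi @` setT = setT.
Proof.
exists (fun t n m => t (pickle (n, m))); apply/seteqP; split=> // y _.
exists (fun k => if unpickle k is Some nm then y nm.1 nm.2 else false) => //.
by apply/funext => n; apply/funext => m; rewrite pickleK.
Qed.

Section bits_real.
Variable R : realType.
Implicit Type t : bits.

(* A sum in base 3 with digits 0 and 1, so that distinct sequences of digits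
   give distinct numbers. *)
Let S t n : R := \sum_(k < n) (t k)%:R * 3^-1 ^+ k.

Let S_ge t n m : (n <= m)%N -> S t n <= S t m.
Proof.
move=> /subnK <-; elim: (m - n)%N => // k ih; apply: le_trans ih _.
rewrite addSn /S big_ord_recr/= lerDl; apply: mulr_ge0 => //.
Qed.

Let S_le t n m : (n <= m)%N -> S t m <= S t n + 3 / 2 * 3^-1 ^+ n.
Proof.
move=> nm; suff : S t m + 3 / 2 * 3^-1 ^+ m <= S t n + 3 / 2 * 3^-1 ^+ n.
  apply: le_trans; rewrite lerDl; apply: mulr_ge0; first lra.
  by apply: exprn_ge0; rewrite invr_ge0.
move: nm => /subnK <-; elim: (m - n)%N => // k ih; apply: le_trans ih.
rewrite addSn /S big_ord_recr/= -addrA lerD2l exprS.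
have : 0 <= 3^-1 ^+ (k + n) :> R by apply: exprn_ge0; rewrite invr_ge0.
by case: (t _) => /= h; lra.
Qed.

Definition ternary t : R := sup [set S t n | n in setT].

Let S_ub t : ubound [set S t n | n in setT] (3 / 2).
Proof.
move=> _ [n _ <-]; apply: le_trans (S_le t (leq0n n)) _.
by rewrite /S big_ord0 expr0; lra.
Qed.

Let ternary_ge t n : S t n <= ternary t.
Proof. by apply: ub_le_sup; [exists (3 / 2); exact: S_ub|exists n]. Qed.

Let ternary_le t n : ternary t <= S t n + 3 / 2 * 3^-1 ^+ n.
Proof.
apply: ge_sup; first by exists (S t 0), 0%N.
move=> _ [m _ <-]; have [nm|/ltnW mn] := leqP n m; first exact: S_le.
apply: le_trans (S_ge t mn) _; rewrite lerDl; apply: mulr_ge0; first lra.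
by apply: exprn_ge0; rewrite invr_ge0.
Qed.

Lemma ternary_bound t : 0 <= ternary t <= 3 / 2.
Proof.
have := ternary_ge t 0; have := ternary_le t 0.
by rewrite /S big_ord0 expr0; lra.
Qed.

Let ternary_lt t u n : (forall k, (k < n)%N -> t k = u k) -> t n = true ->
  u n = false -> ternary u < ternary t.
Proof.
move=> tu tn un; have := ternary_ge t n.+1; have := ternary_le u n.+1.
rewrite /S !big_ord_recr/= tn un.
have -> : \sum_(k < n) (t k)%:R * 3^-1 ^+ k =
          \sum_(k < n) (u k)%:R * 3^-1 ^+ k :> R.
  by apply: eq_bigr => k _; rewrite tu.
have h : 0 < 3^-1 ^+ n :> R by apply: exprn_gt0; rewrite invr_gt0.
by rewrite exprS/=; lra.
Qed.

Lemma ternary_inj : injective ternary.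
Proof.
move=> t u tu; apply/funext => n.
apply: contrapT => /eqP ntu; have ex : exists n, t n != u n by exists n.
case: (ex_minnP ex) => {ntu ex}n ntu nmin.
have eq k : (k < n)%N -> t k = u k.
  by move=> kn; apply/eqP; apply: contraTT kn => /nmin; rewrite leqNgt.
have eq' k : (k < n)%N -> u k = t k by move/eq.
case tn : (t n) ntu => //; case un : (u n) => // _.
- by have := ternary_lt eq tn un; rewrite tu ltxx.
- by have := ternary_lt eq' un tn; rewrite tu ltxx.
Qed.

(** A real number is determined by the rational numbers below it. *)
Lemma real_of_bits : exists f : bits -> R, f @` setT = setT.
Proof.
pose c (x : R) : bits :=
  fun n => if unpickle n is Some q then ratr q < x else false.
have cinj : injective c.
  suff H x y : x < y -> c x <> c y.
    move=> x y cxy; have [xy|yx|//] := ltgtP x y.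
      by case: (H _ _ xy).
    by case: (H _ _ yx).
  move=> xy cxy; have [q] := rat_in_itvoo xy.
  rewrite in_itv/= => /andP[xq qy].
  have := congr1 (@^~ (pickle q)) cxy; rewrite /c pickleK qy.
  by rewrite (lt_gtF xq).
exists (fun t => xget 0 [set x | c x = t]); apply/seteqP; split=> // x _.
exists (c x) => //; case: xgetP => [y _ /= /cinj //|/(_ x) /= nx].
by case: nx.
Qed.

End bits_real.

(** B contains a compact set K of positive measure m. The function phi x, the
    measure of the part of K on the left of x, is 1-Lipschitz and increases
    from 0 to m. The least x at which it takes a value in ]0, m[ belongs to K,
    since phi is constant near the points off K; so phi maps K onto ]0, m[,
    which contains a copy of the set of binary sequences. *)
Lemma positive_measure_surj (R : realType) (B : set R) :
  measurable B -> (0 < lebesgue_measure B)%E ->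
  exists h : R -> bits, h @` B = setT.
Proof.
move=> mB B0; pose mu := @lebesgue_measure R.
have [K [cK KB K0 Koo]] : exists K : set R,
    [/\ compact K, K `<=` B, (0 < mu K)%E & (mu K < +oo)%E].
  move: B0; rewrite (lebesgue_regularity_inner_sup mB) => /ereal_sup_gt[].
  move=> _ [K [cK KB] <-] K0; exists K; split=> //.
  exact: compact_finite_measure.
have mK : measurable K by exact: compact_measurable.
pose phi (x : R) : R := fine (mu (K `&` `]-oo, x])).
have mKx x : measurable (K `&` `]-oo, x]) by exact: measurableI.
have fKx x : mu (K `&` `]-oo, x]) \is a fin_num.
  rewrite ge0_fin_numE//; apply: le_lt_trans Koo.
  exact: measureIl.
have phiB x y : x <= y -> phi y = phi x + fine (mu (K `&` `]x, y])).
  move=> xy; rewrite /phi -fineD//; last first.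
    rewrite ge0_fin_numE//; apply: le_lt_trans Koo.
    exact: measureIl.
  congr fine; rewrite -measureU//.
  - rewrite -setIUr; congr (mu (_ `&` _)).
    by rewrite -itv_bndbnd_setU// bnd_simp.
  - exact: measurableI.
  - exact: measurableI.
  - rewrite -setIIr; apply/seteqP; split=> // z /=.
    by rewrite !in_itv/= => -[_ [zx /andP[xz _]]]; have := le_lt_trans zx xz; rewrite ltxx.
have phi_lip x y : x <= y -> phi x <= phi y <= phi x + (y - x).
  move=> xy; rewrite (phiB _ _ xy) lerDl fine_ge0//= lerD2l.
  rewrite -lee_fin fineK; last first.
    rewrite ge0_fin_numE//; apply: le_lt_trans Koo.
    exact: measureIl.
  apply: (@le_trans _ _ (mu `]x, y]%classic)).
    exact: measureIr.
  by rewrite /mu lebesgue_measure_itv/= lte_fin; case: ltP => // yx;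
    rewrite lee_fin; lra.
have [M [MR KM]] := compact_bounded cK.
pose a : R := `|M| + 1.
have Ka x : K x -> `|x| <= a.
  move=> Kx; apply: (KM a) => //; rewrite /a.
  by have := ler_norm M; lra.
have phia : phi a = fine (mu K).
  rewrite /phi; congr (fine (mu _)); apply/setIidPl => x /Ka/=.
  by rewrite in_itv/=; have := ler_norm x; lra.
have phiNa : phi (- a - 1) = 0.
  rewrite /phi (_ : K `&` _ = set0); first by rewrite /mu measure0.
  apply/seteqP; split=> // x /= [/Ka]; rewrite in_itv/= => xa xa'.
  by have := ler_norm (- x); rewrite normrN; move: xa xa'; rewrite /a; lra.
set m := fine (mu K) in phia.
have m0 : 0 < m by rewrite fine_gt0// K0.
have onto (v : R) : 0 < v < m -> exists2 x, K x & phi x = v.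
  move=> /andP[v0 vm].
  have a0 : 0 <= a by rewrite /a; have := normr_ge0 M; lra.
  pose A := [set x : R | v <= phi x].
  have Alb : has_lbound A.
    exists (- a - 1) => x; rewrite /A/= => vx; rewrite leNgt; apply/negP => xa.
    by have /andP[] := phi_lip _ _ (ltW xa); rewrite phiNa; lra.
  have An0 : A !=set0 by exists a; rewrite /A/= phia; lra.
  pose x : R := inf A.
  have lt_x (y : R) : y < x -> phi y < v.
    move=> yx; rewrite ltNge; apply/negP => vy.
    by have : x <= y; [exact: ge_inf|rewrite leNgt yx].
  have phix : v <= phi x.
    rewrite leNgt; apply/negP => xv.
    have [y Ay yx] : exists2 y, A y & y < x + (v - phi x).
      by apply: inf_lt => //; rewrite /x; lra.
    have xy : x <= y by exact: ge_inf.
    by have /andP[_] := phi_lip _ _ xy; move: Ay; rewrite /A/=; lra.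
  have phixv : phi x = v.
    apply/eqP; rewrite eq_le phix andbT leNgt; apply/negP => vx.
    have yx : x - (phi x - v) / 2 < x by lra.
    have /andP[_] := phi_lip _ _ (ltW yx); have := lt_x _ yx; lra.
  exists x => //; apply: contrapT => nKx.
  have cK' : closed K by apply: compact_closed => //; exact: Rhausdorff.
  have : nbhs x (~` K).
    by apply: open_nbhs_nbhs; split=> //; exact: closed_openC.
  move=> /nbhs_ballP[e /= e0 eK].
  have yx : x - e / 2 < x by lra.
  have := lt_x _ yx; rewrite ltNge => /negP; apply.
  rewrite -phixv (phiB _ _ (ltW yx)) (_ : K `&` _ = set0).
    by rewrite /mu measure0/= addr0.
  apply/seteqP; split=> // z [Kz] /=; rewrite in_itv/= => /andP[z1 z2].
  by apply: (eK z) => //; rewrite /ball/= ger0_norm; lra.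
exists (fun x => xget (fun=> true) [set t | m / 4 * (1 + ternary R t) = phi x]).
apply/seteqP; split=> // t _.
have [|x Kx xt] := onto (m / 4 * (1 + ternary R t)).
  have := ternary_bound R t; set r := ternary R t; nra.
exists x; first exact: KB.
case: xgetP => [u _ /= |/(_ t) /=]; rewrite xt//.
have m40 : m / 4 != 0 by apply: lt0r_neq0; lra.
by move=> /(mulfI m40)/addrI/ternary_inj.
Qed.

Section borel_codes.
Variable R : realType.

(** Codes of Borel sets: well-founded trees that build a set from open
    half-planes, whose boundary has a real coordinate coded by a binary
    sequence. *)
Inductive code :=
| Half of bool & bits
| Compl of code
| Union of (nat -> code).

Fixpoint decode (v : bits -> R) c : set (R * R) :=
  match c with
  | Half b t => [set p | v t < (if b then p.1 else p.2)]
  | Compl c => ~` decode v c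
  | Union f => \bigcup_n decode v (f n)
  end.

(* The label at the root. A tree is determined by the labels that are reached
   along finite branches, that is by one binary sequence. *)
Let label c : bits :=
  match c with
  | Half b t => fun k => match k with 0 => true | 1 => b | k'.+2 => t k' end
  | Compl _ => fun k => k == 1%N
  | Union _ => fun=> false
  end.

Fixpoint labels c (s : seq nat) : bits :=
  match s, c with
  | n :: s', Compl c' => labels c' s'
  | n :: s', Union f => labels (f n) s'
  | _, _ => label c
  end.

Lemma labels_inj : injective labels.
Proof.
elim=> [b t|c ih|f ih] [b' t'|c'|f'] e; have e0 := congr1 (@^~ [::]) e.
- have eb := congr1 (@^~ 1%N) e0; rewrite /= in eb; rewrite eb.
  by congr Half; apply/funext => k; exact: (congr1 (@^~ k.+2) e0).
- by have := congr1 (@^~ 0%N) e0.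
- by have := congr1 (@^~ 0%N) e0.
- by have := congr1 (@^~ 0%N) e0.
- congr Compl; apply: ih; apply/funext => s.
  exact: (congr1 (@^~ (0%N :: s)) e).
- by have := congr1 (@^~ 1%N) e0.
- by have := congr1 (@^~ 0%N) e0.
- by have := congr1 (@^~ 1%N) e0.
- congr Union; apply/funext => n; apply: ih; apply/funext => s.
  exact: (congr1 (@^~ (n :: s)) e).
Qed.

Lemma bits_code : exists f : bits -> code, f @` setT = setT.
Proof.
pose enc c : bits := fun k =>
  if unpickle k is Some sn then labels c sn.1 sn.2 else false.
have enc_inj : injective enc.
  move=> c c' e; apply: labels_inj; apply/funext => s; apply/funext => n.
  by have := congr1 (@^~ (pickle (s, n))) e; rewrite /enc pickleK.
pose c0 := Half true (fun=> true).
exists (fun t => if pselect (exists c, enc c = t) is left h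
         then projT1 (cid h) else c0).
apply/seteqP; split=> // c _; exists (enc c) => //.
case: pselect => [h|[]]; last by exists c.
by case: (cid h) => c' /= /enc_inj.
Qed.

Lemma borel_code (v : bits -> R) (A : set (R * R)) :
  v @` setT = setT -> measurable A -> exists c, decode v c = A.
Proof.
move=> vT; pose B := [set A | exists c, decode v c = A].
have BC X : B X -> B (~` X) by move=> [c <-]; exists (Compl c).
have BU (F : nat -> set (R * R)) : (forall n, B (F n)) -> B (\bigcup_n F n).
  by move=> /choice[c cF]; exists (Union c); apply: eq_bigcupr => n _.
have B0 : B set0.
  pose c0 := Half true (fun=> true).
  exists (Compl (Union (fun n => if n is 0 then c0 else Compl c0))).
  apply/seteqP; split=> // p /=; apply.
  have [h|h] := pselect (decode v c0 p); first by exists 0%N.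
  by exists 1%N.
have half (b : bool) (x : R) : B [set p | x < (if b then p.1 else p.2)].
  have : [set: R] x by [].
  by rewrite -vT => -[t _ <-]; exists (Half b t).
have halves (b : bool) (Y : set R) : measurable Y ->
    B [set p | Y (if b then p.1 else p.2)].
  have -> : (measurable : set (set R)) = <<s @RGenOInfty.G R >>.
    exact: RGenOInfty.measurableE.
  pose BY := [set Y : set R | B [set p | Y (if b then p.1 else p.2)]].
  move: Y; change (<<s @RGenOInfty.G R >> `<=` BY).
  apply: smallest_sub; rewrite /BY; last first.
    move=> _ [x ->]; have := half b x; congr B.
    by apply/seteqP; split=> p /=; rewrite in_itv/= andbT.
  split=> /=.
  - exact: B0.
  - by move=> Y' /= /BC; congr B; apply/seteqP; split=> p //= -[].
  - by move=> F BF /=; exact: BU BF.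
move: A; change ((measurable : set (set (R * R))) `<=` B).
apply: smallest_sub; last first.
  move=> X [] /= [Y mY <-]; rewrite setTI.
  - exact: (halves true).
  - exact: (halves false).
split=> //.
- by move=> X /BC; rewrite setTD.
Qed.

End borel_codes.

Section sparse.
Variable R : realType.
Implicit Types (E N : set (R * R)).

(** p - q is proportional to the rational vector (m, n), or is 0. *)
Definition rational_direction (p q : R * R) := exists m n : rat,
  [/\ (m != 0) || (n != 0) & (p.1 - q.1) * ratr n = (p.2 - q.2) * ratr m].

(** The lines of rational slope, including the horizontal and the vertical
    ones, meet E in at most one point. *)
Definition sparse E := forall p q, E p -> E q -> rational_direction p q -> p = q.

Lemma conull_pos (A : set R) : measurable A ->
  lebesgue_measure (~` A) = 0%E -> (0 < lebesgue_measure A)%E.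
Proof.
move=> mA A0; rewrite lt0e measure_ge0 andbT; apply/eqP => A0'.
have : (@lebesgue_measure R `[0%R, 1%R] <= 0)%E.
  rewrite -(adde0 0%E) -{1}A0' -A0 -measureU; last 3 first.
  - exact: mA.
  - exact: measurableC.
  - exact: setICr.
  by rewrite setUv; apply: le_measure; rewrite ?inE.
by rewrite lebesgue_measure_itv/= lte_fin ltr01 oppr0 adde0 lee_fin ler10.
Qed.

Lemma null_section N : measurable N -> leb2 N = 0%E ->
  exists A : set R, [/\ measurable A, (0 < lebesgue_measure A)%E &
    forall a, A a -> lebesgue_measure (xsection N a) = 0%E].
Proof.
move=> mN N0; pose F := @lebesgue_measure R \o xsection N.
have mF : measurable_fun setT F by exact: measurable_fun_xsection.
have : ae_eq lebesgue_measure setT F (cst 0%E).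
  apply/ae_eq_integral_abs => //; rewrite -[RHS]N0 /leb2 /product_measure1.
  by apply: eq_integral => x _; rewrite /F /= gee0_abs.
pose A := F @^-1` [set 0%E].
have mA : measurable A by rewrite -[A]setTI; exact: mF.
move=> ae0; exists A; split => //; apply: conull_pos => //.
apply: measure_negligible; first exact: measurableC.
by apply: negligibleS ae0 => x /= Ax /(_ I).
Qed.

(** The step of the recursion, where the x i for i in D are the points chosen
    before. By Fubini almost every vertical section of N is null. The abscissa
    is chosen among those of the null sections, away from the abscissas of the
    x i. On that vertical line, each x i and each rational slope exclude one
    ordinate; these do not exhaust the complement of the section of N. *)
Lemma null_escape N (D : set bits) (x : bits -> R * R) :
  measurable N -> leb2 N = 0%E -> small D ->
  exists p, ~ N p /\ forall i, D i -> ~ rational_direction p (x i).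
Proof.
move=> mN N0 sD; have [pi piT] := bits_power.
have [A [mA A0 NA]] := null_section mN N0.
have [h hA] := positive_measure_surj mA A0.
have [t tP] := small_bigcup (fun _ i => h (x i).1) piT sD.
have : setT t by []; rewrite -hA => -[a Aa hat].
have mS : measurable (xsection N a) by exact: measurable_xsection.
have S0 : (0 < lebesgue_measure (~` xsection N a))%E.
  by apply: conull_pos; [exact: measurableC|rewrite setCK NA].
have [k kS] := positive_measure_surj (measurableC mS) S0.
pose f n i := k (if unpickle n is Some q
  then (x i).2 + (a - (x i).1) * ratr (q : rat) else 0).
have [u uP] := small_bigcup f piT sD.
have : setT u by []; rewrite -kS => -[b /= Nb kbu].
exists (a, b); split=> [Nab|i Di [m [n [mn0]]]].
  by apply: Nb; rewrite xsectionE.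
rewrite /=; have [m0|m0] := eqVneq m 0.
  rewrite m0 rmorph0 mulr0 => /eqP; rewrite mulf_eq0 subr_eq0 => /orP[/eqP ax|].
    by apply: (tP 0%N i Di); rewrite -ax.
  by rewrite fmorph_eq0 => /eqP n0; move: mn0; rewrite m0 n0 eqxx.
move=> e; apply: (uP (pickle (n / m)) i Di).
rewrite /f pickleK -kbu; congr k.
rewrite fmorph_div mulrA e -mulrA divff ?fmorph_eq0// mulr1.
by rewrite addrC subrK.
Qed.

(** The points of E are chosen one for each Borel null set, outside it. *)
Theorem sparse_nonnull : exists E, sparse E /\
  forall N, measurable N -> leb2 N = 0%E -> exists2 p, E p & ~ N p.
Proof.
have [lt [W [g [lt_wf lt_tri Wsmall gW]]]] := short_well_order bits.
have [v vT] := real_of_bits R; have [dec decT] := bits_code.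
pose Nl w := decode v (dec (g w)).
pose Q w (S : set (R * R)) p :=
  (measurable (Nl w) -> leb2 (Nl w) = 0%E -> ~ Nl w p) /\
  forall q, S q -> ~ rational_direction p q.
have [w x Ww|x xP] := @transfinite_choice _ (R * R)%type lt W Q lt_wf.
  have [[mN N0]|nN] := pselect (measurable (Nl w) /\ leb2 (Nl w) = 0%E).
    have [p [Np pP]] := null_escape x mN N0 (Wsmall w Ww).
    by exists p; split=> // _ [i /= iw <-]; exact: pP.
  have [||p [_ pP]] := @null_escape set0 _ x _ _ (Wsmall w Ww) => //.
  exists p; split=> [mN N0|_ [i /= iw <-]]; last exact: pP.
  by case: nN.
have rd_sym p q : rational_direction p q -> rational_direction q p.
  move=> [m [n [mn0 e]]]; exists m, n; split=> //.
  by rewrite -(opprB p.1) -(opprB p.2) !mulNr e.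
exists (x @` W); split.
  move=> _ _ [i Wi <-] [j Wj <-] rd; have [ij|->//|ji] := lt_tri i j.
  - by have [_ /(_ (x i))[]] := xP j Wj; [exists i|exact: rd_sym].
  - by have [_ /(_ (x j))[]] := xP i Wi; [exists j|].
move=> N mN N0; have [c cN] := borel_code vT mN.
have : setT c by []; rewrite -decT => -[b _ bc].
have : setT b by []; rewrite -gW => -[w Ww wb].
exists (x w); first by exists w.
have [+ _] := xP w Ww; rewrite /Nl wb bc cN; exact.
Qed.

(** The Borel part of E has vertical sections with at most one point, so it is
    null; then all of E would be contained in a Borel null set. *)
Lemma sparse_nonmeasurable E : sparse E ->
  (forall N, measurable N -> leb2 N = 0%E -> exists2 p, E p & ~ N p) ->
  ~ leb2_measurable E.
Proof.
move=> sE nE [A mA [B [M [mM M0 BM]] AB]].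
have AE : A `<=` E by rewrite -AB; exact: subsetUl.
have A0 : leb2 A = 0%E.
  rewrite /leb2 /product_measure1; apply: integral0_eq => x _ /=.
  have [->|/set0P[y Ay]] := eqVneq (xsection A x) set0.
    by rewrite measure0.
  rewrite (_ : xsection A x = [set y]) ?lebesgue_measure_set1//.
  apply/seteqP; split=> [z|_ ->//].
  move: Ay; rewrite !xsectionE /= => Ay Az.
  suff [] : (x, z) = (x, y) by [].
  apply: sE; [exact: AE|exact: AE|]; exists 0, 1; split.
    by rewrite oner_neq0 orbT.
  by rewrite /= subrr mul0r rmorph0 mulr0.
have [|e Ee] := nE (A `|` M) (measurableU _ _ mA mM).
  apply/eqP; rewrite -measure_le0.
  apply: (le_trans (measureU2 (lebesgue_measure \x lebesgue_measure)%E mA mM)).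
  by rewrite [X in (X + _)%E]A0 [X in (_ + X)%E]M0 adde0.
by apply; move: Ee; rewrite -AB => -[?|/BM]; [left|right].
Qed.

End sparse.

(** * Length of paths and arc-length parametrization *)

Section euclidean_distance.
Variable R : realType.
Implicit Types x y z : R * R.

Lemma edist_ge0 x y : 0 <= edist x y.
Proof. exact: sqrtr_ge0. Qed.

Lemma edistxx x : edist x x = 0.
Proof. by rewrite /edist !subrr expr0n/= addr0 sqrtr0. Qed.

Lemma edistC x y : edist x y = edist y x.
Proof. by rewrite /edist -(opprB y.1) -(opprB y.2) !sqrrN. Qed.

Lemma edist_sqr x y : edist x y ^+ 2 = (x.1 - y.1) ^+ 2 + (x.2 - y.2) ^+ 2.
Proof. by rewrite sqr_sqrtr// addr_ge0// sqr_ge0. Qed.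

Lemma edist_triangle y x z : edist x z <= edist x y + edist y z.
Proof.
have := edist_sqr x z; have := edist_sqr x y; have := edist_sqr y z.
have := edist_ge0 x z; have := edist_ge0 x y; have := edist_ge0 y z.
set u := edist x z; set v := edist x y; set w := edist y z.
have -> : x.1 - z.1 = (x.1 - y.1) + (y.1 - z.1) by lra.
have -> : x.2 - z.2 = (x.2 - y.2) + (y.2 - z.2) by lra.
move: (x.1 - y.1) (y.1 - z.1) (x.2 - y.2) (y.2 - z.2) => a b c d.
move=> w0 v0 u0 ew ev eu.
have vw0 : 0 <= v * w by rewrite mulr_ge0.
suff : a * b + c * d <= v * w.
  move=> h; rewrite -(@ler_pXn2r _ 2)// ?nnegrE ?addr_ge0//.
  by rewrite eu (sqrrD v w) ev ew; lra.
have [h|h] := leP (a * b + c * d) 0; first exact: le_trans vw0.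
rewrite -(@ler_pXn2r _ 2)// ?nnegrE ?(ltW h)// exprMn ev ew.
rewrite -subr_ge0.
have -> : (a ^+ 2 + c ^+ 2) * (b ^+ 2 + d ^+ 2) - (a * b + c * d) ^+ 2 =
  (a * d - b * c) ^+ 2 by ring.
exact: sqr_ge0.
Qed.

Lemma normr_edist1 x y : `|x.1 - y.1| <= edist x y.
Proof.
rewrite -(@ler_pXn2r _ 2)// ?nnegrE ?edist_ge0// edist_sqr real_normK ?num_real//.
by rewrite lerDl sqr_ge0.
Qed.

Lemma normr_edist2 x y : `|x.2 - y.2| <= edist x y.
Proof.
rewrite -(@ler_pXn2r _ 2)// ?nnegrE ?edist_ge0// edist_sqr real_normK ?num_real//.
by rewrite lerDr sqr_ge0.
Qed.

Lemma edist_le_norm x y : edist x y <= `|x.1 - y.1| + `|x.2 - y.2|.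
Proof.
rewrite -(@ler_pXn2r _ 2)// ?nnegrE ?edist_ge0 ?addr_ge0// edist_sqr (sqrrD `|_|).
rewrite !real_normK ?num_real// addrAC lerDl mulrn_wge0// mulr_ge0//.
Qed.

Lemma edist_le0 x y : edist x y <= 0 -> x = y.
Proof.
move=> xy; have := normr_edist1 x y; have := normr_edist2 x y.
move=> /le_trans/(_ xy); rewrite normr_le0 subr_eq0 => /eqP e2.
move=> /le_trans/(_ xy); rewrite normr_le0 subr_eq0 => /eqP e1.
by rewrite (surjective_pairing x) (surjective_pairing y) e1 e2.
Qed.

End euclidean_distance.

Section path_length.
Variable R : realType.
Implicit Types (p : R -> R * R) (a b c : R) (s : seq R).

(** [polygonal_length] by recursion on the partition. *)
Fixpoint plen p a s : R :=
  if s is x :: s' then edist (p x) (p a) + plen p x s' else 0.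

Lemma polygonal_lengthE a b p s : polygonal_length a b p s = plen p a s.
Proof.
rewrite /polygonal_length; elim: s a => [a|x s ih a]; first by rewrite big_nil.
by rewrite [size _]/= big_nat_recl//= ih.
Qed.

Lemma plen_cat p a s t : plen p a (s ++ t) = plen p a s + plen p (last a s) t.
Proof. by elim: s a => [a|x s ih a]/=; rewrite ?add0r// ih addrA. Qed.

Lemma plen_le_path_length p a b s : itv_partition a b s ->
  ((plen p a s)%:E <= path_length a b p)%E.
Proof.
by move=> abs; apply: ereal_sup_ubound; exists s; rewrite ?polygonal_lengthE.
Qed.

Lemma path_length_le p a b (c : \bar R) :
  (forall s, itv_partition a b s -> ((plen p a s)%:E <= c)%E) ->
  (path_length a b p <= c)%E.
Proof.
by move=> h; apply: ge_ereal_sup => _ [s abs <-]; rewrite polygonal_lengthE h.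
Qed.

Lemma edist_le_path_length p a b : a <= b ->
  ((edist (p b) (p a))%:E <= path_length a b p)%E.
Proof.
rewrite le_eqVlt => /predU1P[<-|ab].
  rewrite edistxx; have := @plen_le_path_length p a a [::]; apply.
  by split.
have := plen_le_path_length p (itv_partition1 ab).
by rewrite /= addr0.
Qed.

Lemma path_length_ge0 p a b : a <= b -> (0 <= path_length a b p)%E.
Proof.
move=> ab; apply: le_trans (edist_le_path_length p ab).
by rewrite lee_fin edist_ge0.
Qed.

Lemma path_lengthxx p a : path_length a a p = 0%E.
Proof.
apply/eqP; rewrite eq_le path_length_ge0// andbT.
by apply: path_length_le => s /itv_partitionxx ->.
Qed.

Lemma path_length_superadd p a b c : a <= c -> c <= b ->
  (path_length a c p + path_length c b p <= path_length a b p)%E.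
Proof.
move=> ac cb; have := path_length_ge0 p (le_trans ac cb).
move: (path_length_ge0 p ac) (path_length_ge0 p cb).
have H s t : itv_partition a c s -> itv_partition c b t ->
    ((plen p a s)%:E + (plen p c t)%:E <= path_length a b p)%E.
  move=> acs cbt; rewrite -EFinD.
  have <- : plen p a (s ++ t) = plen p a s + plen p c t.
    by rewrite plen_cat; case: acs => _ /eqP ->.
  exact/plen_le_path_length/(itv_partition_cat acs cbt).
move: H; case: (path_length a b p) => [z||] H; rewrite ?leey// => ac0 cb0 _.
have H1 t : itv_partition c b t ->
    (path_length a c p <= z%:E - (plen p c t)%:E)%E.
  by move=> cbt; apply: path_length_le => s acs; rewrite leeBrDr// H.
move: H1 ac0; case: (path_length a c p) => [x| |] H1 ac0 //.
- rewrite addeC -leeBrDr//; apply: path_length_le => t cbt.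
  by rewrite leeBrDr// addeC -leeBrDr// H1.
- have [cb'|cb'] := ltP c b; last first.
    have e : c = b by apply/eqP; rewrite eq_le cb cb'.
    by have := H1 [::]; rewrite e => /(_ (conj isT (eqxx _))).
  by have := H1 _ (itv_partition1 cb').
Qed.

(** Inserting a point in a partition does not decrease the length, by the
    triangle inequality. *)
Lemma plen_split p a b c s : a <= c -> c <= b -> itv_partition a b s ->
  exists s1 s2, [/\ itv_partition a c s1, itv_partition c b s2 &
    plen p a s <= plen p a s1 + plen p c s2].
Proof.
elim: s a => [|x s ih] a ac cb abs.
  have ab := itv_partition_nil abs; have e : a = c.
    by apply/eqP; rewrite eq_le ac ab cb.
  by subst c b; exists [::], [::]; split=> //=; rewrite addr0.
move: ac; rewrite le_eqVlt => /predU1P[e|ac].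
  by subst c; exists [::], (x :: s); split=> //; rewrite add0r.
have [/= /andP[ax xs] /eqP lb] := abs; have xbs := itv_partition_cons abs.
have [cx|xc|e] := ltgtP c x.
- exists [:: c], (x :: s); split; first exact: itv_partition1.
    by split=> /=; rewrite ?cx ?xs ?lb.
  rewrite /= addr0 addrA lerD2r (edistC (p x)) (edistC (p c)).
  by rewrite (edistC (p x)) edist_triangle.
- have [s1 [s2 [p1 p2 le12]]] := ih x (ltW xc) cb xbs.
  exists (x :: s1), s2; split=> //.
    by case: p1 => xs1 l1; split=> //=; rewrite ax.
  by rewrite /= -addrA lerD2l.
- by subst x; exists [:: c], s; split; [exact: itv_partition1|done|rewrite /= addr0].
Qed.

Lemma path_length_subadd p a b c : a <= c -> c <= b ->
  (path_length a b p <= path_length a c p + path_length c b p)%E.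
Proof.
move=> ac cb; apply: path_length_le => s /(plen_split p ac cb)[s1 [s2 [p1 p2]]].
rewrite -lee_fin EFinD => /le_trans; apply.
by apply: leeD; exact: plen_le_path_length.
Qed.

Lemma path_length_shift p a b c :
  path_length a b (fun t => p (t + c)) = path_length (a + c) (b + c) p.
Proof.
have H (q : R -> R * R) (x y d : R) : (path_length x y (fun t => q (t + d)%R) <=
    path_length (x + d)%R (y + d)%R q)%E.
  apply: path_length_le => s xys.
  have -> : plen (fun t => q (t + d)) x s = plen q (x + d) (map (+%R^~ d) s).
    by elim: s x {xys} => //= z s ih x; rewrite ih.
  apply: plen_le_path_length; case: xys => xs /eqP <-.
  split; last by rewrite (last_map (+%R^~ d)).
  by elim: s x xs => //= z s ih x /andP[xz zs]; rewrite ltrD2r xz ih.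
apply/eqP; rewrite eq_le H/=.
have := H (fun t => p (t + c)) (a + c) (b + c) (- c); rewrite !addrK.
by under [X in path_length _ _ X]eq_fun do rewrite subrK.
Qed.

Lemma itv_partition_in a b s x : itv_partition a b s -> x \in a :: s ->
  a <= x <= b.
Proof.
elim: s a => [a /itv_partition_nil <-|y s ih a abs].
  by rewrite inE => /eqP ->; rewrite lexx.
rewrite inE => /predU1P[->|].
  by rewrite lexx (itv_partition_le abs).
move=> /(ih _ (itv_partition_cons abs))/andP[yx ->]; rewrite andbT.
by apply: le_trans yx; case: abs => /= /andP[/ltW].
Qed.

Lemma eq_path_length p q a b : (forall t, a <= t <= b -> p t = q t) ->
  path_length a b p = path_length a b q.
Proof.
have H p' q' : (forall t, a <= t <= b -> p' t = q' t) ->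
    (path_length a b p' <= path_length a b q')%E.
  move=> pq; apply: path_length_le => s abs.
  suff -> : plen p' a s = plen q' a s by exact: plen_le_path_length.
  have : {in a :: s, p' =1 q'} by move=> x /(itv_partition_in abs)/pq.
  elim: s a {abs pq} => //= y s ih x e.
  rewrite ih; last by move=> z zs; apply: e; rewrite inE zs orbT.
  by rewrite !e// !inE eqxx ?orbT.
move=> pq; apply/eqP; rewrite eq_le !H//.
by move=> t tab; rewrite pq.
Qed.

(** This bounds the increments of the length function by those of the total
    variations of the coordinates, whose continuity is known. *)
Lemma path_length_le_tv p a b : a <= b ->
  (path_length a b p <=
   total_variation a b (fst \o p) + total_variation a b (snd \o p))%E.
Proof.
move=> ab; apply: ge_ereal_sup => _ [s abs <-].
apply: (@le_trans _ _ ((variation a b (fst \o p) s)%:E +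
                       (variation a b (snd \o p) s)%:E)%E).
  rewrite -EFinD lee_fin /polygonal_length /variation -big_split/=.
  by apply: ler_sum => n _; exact: edist_le_norm.
by apply: leeD; apply: ereal_sup_ubound => /=; eexists => //; exists s.
Qed.

Lemma tv1_le_path_length p a b :
  (total_variation a b (fst \o p) <= path_length a b p)%E.
Proof.
apply: ge_ereal_sup => _ [_ [s abs <-] <-].
apply: le_trans (plen_le_path_length p abs).
rewrite -(polygonal_lengthE a b) lee_fin.
by apply: ler_sum => n _; exact: normr_edist1.
Qed.

Lemma tv2_le_path_length p a b :
  (total_variation a b (snd \o p) <= path_length a b p)%E.
Proof.
apply: ge_ereal_sup => _ [_ [s abs <-] <-].
apply: le_trans (plen_le_path_length p abs).
rewrite -(polygonal_lengthE a b) lee_fin.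
by apply: ler_sum => n _; exact: normr_edist2.
Qed.

End path_length.

Section lipschitz_paths.
Variable R : realType.
Implicit Types (p : R -> R * R).

Definition lip1 p := forall s t, edist (p s) (p t) <= `|s - t|.

Lemma continuous_fst : continuous (fst : R * R -> R).
Proof. by move=> [x y]; exact: cvg_fst. Qed.

Lemma continuous_snd : continuous (snd : R * R -> R).
Proof. by move=> [x y]; exact: cvg_snd. Qed.

Lemma lip1_fst p : lip1 p -> continuous (fst \o p).
Proof.
move=> lp x; apply/cvgrPdist_le => e e0; near=> y.
apply: le_trans (normr_edist1 _ _) _; apply: le_trans (lp _ _) _.
by near: y; exact: cvgr_dist_le.
Unshelve. all: by end_near. Qed.

Lemma lip1_snd p : lip1 p -> continuous (snd \o p).
Proof.
move=> lp x; apply/cvgrPdist_le => e e0; near=> y.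
apply: le_trans (normr_edist2 _ _) _; apply: le_trans (lp _ _) _.
by near: y; exact: cvgr_dist_le.
Unshelve. all: by end_near. Qed.

Lemma lip1_continuous p : lip1 p -> continuous p.
Proof.
move=> lp x; have -> : p = fun t => ((p t).1, (p t).2).
  by apply/funext => t; rewrite -surjective_pairing.
exact: (cvg_pair (lip1_fst lp (x := x)) (lip1_snd lp (x := x))).
Qed.

Lemma lip1_measurable p : lip1 p -> measurable_fun setT p.
Proof.
move=> lp; have -> : p = fun t => ((p t).1, (p t).2).
  by apply/funext => t; rewrite -surjective_pairing.
by apply: measurable_fun_pair; apply: continuous_measurable_fun;
  [exact: (lip1_fst lp)|exact: (lip1_snd lp)].
Qed.

Lemma lip1_path_length p a b : lip1 p -> a <= b ->
  (path_length a b p <= (b - a)%:E)%E.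
Proof.
move=> lp ab; apply: path_length_le => s; rewrite lee_fin.
elim: s a {ab} => [a /itv_partition_nil ->|x s ih a abs].
  by rewrite subrr.
have ax : a <= x by case: abs => /= /andP[/ltW].
have := ih _ (itv_partition_cons abs); have := lp x a.
by rewrite /= ger0_norm ?subr_ge0//; lra.
Qed.

(** The length of a 1-Lipschitz path over an interval is at most the length of
    the interval. Equality over [0, T] forces equality over all subintervals,
    by additivity. *)
Lemma unit_speed p T t : lip1 p -> (T%:E <= path_length 0 T p)%E ->
  0 <= t <= T -> path_length 0 t p = t%:E.
Proof.
move=> lp pT /andP[t0 tT]; apply/eqP; rewrite eq_le.
have := lip1_path_length lp t0; rewrite subr0 => h0; rewrite h0/=.
have := lip1_path_length lp tT => hT.
have := le_trans pT (path_length_subadd p t0 tT).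
move=> /le_trans/(_ (leeD (lexx _) hT)).
have := path_length_ge0 p t0; move: h0.
case: (path_length 0 t p) => [x| |]//.
by rewrite -EFinD !lee_fin; lra.
Qed.

Lemma dominated_continuous (A : set R) (V l : R -> R) :
  {within A, continuous V} ->
  {in A &, forall x y, `|l x - l y| <= `|V x - V y|} ->
  {within A, continuous l}.
Proof.
move=> /subspace_continuousP cV lV; apply/subspace_continuousP => x Ax.
apply/cvgrPdist_le => e e0; near=> y.
apply: (@le_trans _ _ `|V x - V y|).
  by apply: lV; rewrite inE//; near: y; exact: near_withinT.
near: y; have /cvgrPdist_le/(_ e e0) := cV x Ax; exact.
Unshelve. all: by end_near. Qed.

(** The length function has the increments of its continuous majorant, the sum
    of the total variations of the coordinates; so it is continuous, and takes
    all intermediate values. *)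
Lemma arclength_exists (g : curve R) (l : R) : rectifiable g ->
  0 <= l <= fine (curve_length g) ->
  exists t, t \in `[clo g, chi g] /\ path_length (clo g) t (cpath g) = l%:E.
Proof.
case: g => a b ab p cp; rewrite /rectifiable /curve_length/= => pfin /andP[l0 lL].
move: ab; rewrite le_eqVlt => /predU1P[e|ab].
  subst b; exists a; rewrite in_itv/= lexx; split=> //.
  by move: lL; rewrite path_lengthxx/= => l0'; congr EFin; lra.
have PLfin x y : a <= x -> x <= y -> y <= b -> path_length x y p \is a fin_num.
  move=> ax xy yb; rewrite ge0_fin_numE ?path_length_ge0//.
  apply: le_lt_trans pfin.
  apply: le_trans (path_length_superadd p ax (le_trans xy yb)).
  apply: le_trans (leeDr _ (path_length_ge0 p ax)).
  apply: le_trans (path_length_superadd p xy yb).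
  exact: (leeDl _ (path_length_ge0 p yb)).
have cpi (h : R * R -> R) : continuous h -> {within `[a, b], continuous (h \o p)}.
  move=> ch; apply/subspace_continuousP => x xab.
  apply: cvg_comp; last exact: ch.
  by have /subspace_continuousP := cp; exact.
have bv1 : bounded_variation a b (fst \o p).
  apply/bounded_variationP; first exact: ltW.
  rewrite ge0_fin_numE ?total_variation_ge0 ?ltW//.
  exact: le_lt_trans (tv1_le_path_length _ _ _) pfin.
have bv2 : bounded_variation a b (snd \o p).
  apply/bounded_variationP; first exact: ltW.
  rewrite ge0_fin_numE ?total_variation_ge0 ?ltW//.
  exact: le_lt_trans (tv2_le_path_length _ _ _) pfin.
have c1 := total_variation_continuous ab (cpi fst continuous_fst) bv1.
have c2 := total_variation_continuous ab (cpi snd continuous_snd) bv2.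
pose V t := fine (total_variation a t (fst \o p)) +
            fine (total_variation a t (snd \o p)).
have cV : {within `[a, b], continuous V}.
  by move=> x; apply: cvgD; [exact: c1|exact: c2].
pose L t := fine (path_length a t p).
have LV x y : a <= x -> x <= y -> y <= b -> 0 <= L y - L x <= V y - V x.
  move=> ax xy yb; have ay := le_trans ax xy.
  have L_ge : L x + fine (path_length x y p) = L y.
    rewrite /L -fineD ?PLfin// ?(le_trans xy)//; congr fine; apply/eqP.
    by rewrite eq_le path_length_superadd// path_length_subadd.
  have fin1 f u v : bounded_variation a b f -> a <= u -> u <= v -> v <= b ->
      total_variation u v f \is a fin_num.
    move=> bf au uv vb; apply/(bounded_variationP _ uv).
    apply: (bounded_variationl uv vb).
    exact: (bounded_variationr au (le_trans uv vb)).
  rewrite -L_ge /V.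
  rewrite !(@total_variationD _ a y x)// !fineD ?fin1// ?(le_trans xy)//.
  have := path_length_le_tv p xy.
  rewrite -[path_length x y p]fineK ?PLfin//.
  rewrite -[total_variation x y _]fineK ?fin1//.
  rewrite -[total_variation x y (snd \o p)]fineK ?fin1//.
  rewrite -EFinD lee_fin; have := fine_ge0 (path_length_ge0 p xy).
  lra.
have cL : {within `[a, b], continuous L}.
  apply: (dominated_continuous cV) => x y.
  rewrite !inE/= !in_itv/= => /andP[ax xb] /andP[ay yb].
  wlog xy : x y ax xb ay yb / x <= y.
    have [xy|/ltW yx] := leP x y; first exact.
    by rewrite distrC (distrC (V x)); exact.
  have := LV x y ax xy yb.
  by rewrite distrC (distrC (V x)) => /andP[h1 h2]; rewrite !ger0_norm; lra.
have [|t tab Lt] := @IVT _ _ _ _ l (ltW ab) cL.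
  rewrite /L path_lengthxx/= minEle maxEle ifT ?ifT ?l0//;
  by rewrite fine_ge0// path_length_ge0// ltW.
exists t; split=> //; rewrite -Lt /L fineK//.
move: tab; rewrite in_itv/= => /andP[a_t tb].
by apply: PLfin.
Qed.

(** The parametrization s is extended to the line by constants, so that it is
    1-Lipschitz everywhere. *)
Lemma arclength_lip1 (g : curve R) : rectifiable g ->
  exists s : R -> R * R, [/\ lip1 s, s 0 = cpath g (clo g),
    s (fine (curve_length g)) = cpath g (chi g) &
    forall l : R, 0 <= l <= fine (curve_length g) -> arclength_param g l = s l].
Proof.
move=> rg; set L : R := fine (curve_length g).
have L0 : 0 <= L by rewrite fine_ge0// path_length_ge0// clo_le_chi.
have sP (l : R) : 0 <= l <= L -> exists t, [/\ clo g <= t <= chi g,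
    path_length (clo g) t (cpath g) = l%:E & arclength_param g l = cpath g t].
  move=> lL; have [t tP] := arclength_exists rg lL.
  rewrite /arclength_param; case: xgetP => [u _ [uab ul]|/(_ t)//].
  by exists u; move: uab; rewrite in_itv/= => uab; split.
have s_lip (l m : R) : 0 <= l -> l <= m -> m <= L ->
    edist (arclength_param g m) (arclength_param g l) <= m - l.
  move=> l0 lm mL; have m0 := le_trans l0 lm; have lL := le_trans lm mL.
  have [|t [/andP[t1 t2] tl ->]] := sP l; first by rewrite l0.
  have [|u [/andP[u1 u2] ul ->]] := sP m; first by rewrite m0.
  have [tu|/ltW ut] := leP t u.
    have := path_length_superadd (cpath g) t1 tu.
    rewrite tl ul => /(le_trans (leeD (lexx _) (edist_le_path_length _ tu))).
    by rewrite -EFinD lee_fin; lra.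
  have := path_length_superadd (cpath g) u1 ut.
  rewrite tl ul => /(le_trans (leeD (lexx _) (edist_le_path_length _ ut))).
  by rewrite -EFinD lee_fin edistC; lra.
pose clamp (l : R) : R := Num.max 0 (Num.min l L).
have clampP (l : R) : 0 <= clamp l <= L.
  by rewrite /clamp le_max lexx/= ge_max L0 ge_min lexx orbT.
have clampE (l : R) : 0 <= l <= L -> clamp l = l.
  by move=> /andP[l0 lL]; rewrite /clamp (min_idPl lL) (max_idPr l0).
have clamp_le (l m : R) : l <= m -> clamp l <= clamp m <= clamp l + (m - l).
  move=> lm; rewrite /clamp !maxEle !minEle.
  by repeat case: ifPn; rewrite -?ltNge => *; lra.
exists (arclength_param g \o clamp); split=> /=.
- move=> l m; wlog lm : l m / l <= m.
    have [lm|/ltW ml] := leP l m; first exact.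
    by rewrite edistC distrC; exact.
  rewrite edistC distrC ger0_norm ?subr_ge0//.
  have /andP[h1 h2] := clamp_le _ _ lm.
  have /andP[h3 _] := clampP l; have /andP[_ h4] := clampP m.
  by apply: le_trans (s_lip _ _ h3 h1 h4) _; lra.
- (* The curve has length 0 up to t, so it is constant there. *)
  rewrite clampE ?lexx//; have [|t [/andP[t1 t2] tl ->]] := sP 0.
    by rewrite lexx.
  apply/edist_le0; rewrite -lee_fin -tl.
  exact: edist_le_path_length.
- (* The curve has length 0 after t, by superadditivity. *)
  rewrite clampE ?lexx ?L0//; have [|t [/andP[t1 t2] tl ->]] := sP L.
    by rewrite L0 lexx.
  apply/esym/edist_le0; rewrite -lee_fin -(@leeD2lE _ L%:E)//.
  rewrite -{1}tl adde0 /L fineK; last first.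
    by rewrite ge0_fin_numE ?path_length_ge0 ?clo_le_chi.
  apply: le_trans (path_length_superadd (cpath g) t1 t2).
  by apply: leeD => //; exact: edist_le_path_length.
- by move=> l lL; rewrite clampE.
Qed.

End lipschitz_paths.

(** * Paths that meet a set countably often *)

Section change_of_variables.
Variable R : realType.
Local Notation mu := (@lebesgue_measure R).
Implicit Types f : R -> \bar R.

Lemma measurable_shift (c : R) : measurable_fun setT
  ((fun x => x + c) : measurableTypeR R -> measurableTypeR R).
Proof. exact: measurable_funD. Qed.

Lemma lebesgue_measure_shift (c : R) (A : set R) : measurable A ->
  pushforward mu ((fun x => x + c) : _ -> measurableTypeR R) A = mu A.
Proof.
move=> mA; apply/esym/lebesgue_measure_unique => //=.
  exact: measurable_shift.
move=> _ _ [[a b]] _ <-.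
rewrite /pushforward (_ : _ @^-1` _ = `](a - c), (b - c)]%classic).
  rewrite !lebesgue_measure_itv/= !lte_fin ltrD2r -!EFinB.
  by congr (if _ then EFin _ else _); rewrite opprB addrA subrK.
by apply/seteqP; split=> x /=; rewrite !in_itv/= ltrBlDr lerBrDr.
Qed.

Lemma ge0_integral_shift f (c a b : R) : measurable_fun setT f ->
  (forall x, 0 <= f x)%E ->
  (\int[mu]_(x in `[a, b]) f (x + c)%R = \int[mu]_(x in `[(a + c)%R, (b + c)%R]) f x)%E.
Proof.
move=> mf f0; rewrite (_ : `[a, b]%classic =
    ((fun x => x + c) : _ -> measurableTypeR R) @^-1` `[a + c, b + c]); last first.
  by apply/seteqP; split=> x /=; rewrite !in_itv/= !lerD2r.
have mc := measurable_shift c.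
transitivity (\int[mu]_(x in (fun x => x + c)%R @^-1` `[(a + c)%R, (b + c)%R])
    (f \o (fun x => x + c)%R) x)%E; first by [].
rewrite -(ge0_integral_pushforward mc)//; last exact: measurable_funS mf.
by apply: eq_measure_integral => //= A mA AS; exact: lebesgue_measure_shift.
Qed.

Lemma ge0_integral_shiftT f (c : R) : measurable_fun setT f ->
  (forall x, 0 <= f x)%E ->
  (\int[mu]_x f (x + c)%R = \int[mu]_x f x)%E.
Proof.
move=> mf f0.
have mc := measurable_shift c.
rewrite -[X in integral _ X _](preimage_setT (fun x => x + c)).
transitivity (\int[mu]_(x in (fun x => x + c)%R @^-1` setT)
    (f \o (fun x => x + c)%R) x)%E; first by [].
rewrite -(ge0_integral_pushforward mc)//.
by apply: eq_measure_integral => //= A mA AS; exact: lebesgue_measure_shift.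
Qed.

Lemma ge0_integral_opp f (a b : R) : measurable_fun setT f ->
  (forall x, 0 <= f x)%E ->
  (\int[mu]_(x in `[a, b]) f (- x)%R = \int[mu]_(x in `[(- b)%R, (- a)%R]) f x)%E.
Proof.
move=> mf f0; rewrite (_ : `[a, b]%classic =
    (-%R : _ -> measurableTypeR R) @^-1` `[- b, - a]); last first.
  by rewrite opp_preimage_itvbndbnd !opprK.
rewrite -ge0_integral_pushforward//=; last exact: measurable_funS mf.
by apply: eq_measure_integral => //= A mA AS; exact: lebesgue_measureN.
Qed.

(** Otherwise f exceeds c on D, and so does its average. *)
Lemma exists_le_average d (T : measurableType d)
    (m : {measure set T -> \bar R}) (D : set T) (f : T -> \bar R) (c : R) :
  measurable D -> measurable_fun setT f -> (forall x, 0 <= f x)%E ->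
  0 <= c -> (\int[m]_(x in D) f x < c%:E * m D)%E ->
  exists2 x, D x & (f x <= c%:E)%E.
Proof.
move=> mD mf f0 c0 fc; apply: contrapT => nex.
have cf x : D x -> (c%:E <= f x)%E.
  move=> Dx; rewrite leNgt; apply/negP => /ltW fxc.
  by apply: nex; exists x.
move: fc; apply/negP; rewrite -leNgt -integral_cst//.
apply: ge0_le_integral => //.
- exact: measurable_funS mf.
Qed.

End change_of_variables.

Lemma countable_setU T (A B : set T) :
  countable A -> countable B -> countable (A `|` B).
Proof.
move=> cA cB; rewrite -bigcup2E; apply: bigcup_countable => // -[|[|n]] _ //=.
Qed.

Section good_paths.
Variables (R : realType) (E : set (R * R)) (rho : R * R -> \bar R).
Hypotheses (mrho : measurable_fun setT rho) (rho0 : forall x, (0 <= rho x)%E).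
Local Notation mu := (@lebesgue_measure R).
Implicit Types (p q : R -> R * R) (u v w : R * R) (c d : \bar R) (a b T : R).

Definition path_cost p a b := (\int[mu]_(t in `[a, b]) rho (p t))%E.

(** For a 1-Lipschitz path, the third condition says that p has unit speed on
    [0, T], so that p is its own arc-length parametrization. *)
Definition good_path p T := [/\ 0 <= T, lip1 p, (T%:E <= path_length 0 T p)%E &
  countable (E `&` p @` `[0, T])].

(** The competitors for the curves that meet E countably often: a curve from u
    to v whose rho-length is at most c. Cost bounds and unions of the traces
    are all that has to be tracked when such curves are put end to end. *)
Definition linked u v c := exists p T,
  [/\ good_path p T, p 0 = u, p T = v & (path_cost p 0 T <= c)%E].

Lemma measurable_rho_path p : lip1 p -> measurable_fun setT (rho \o p).
Proof. by move=> /lip1_measurable mp; exact: measurableT_comp. Qed.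

Lemma path_cost_ge0 p a b : (0 <= path_cost p a b)%E.
Proof. exact: integral_ge0. Qed.

Lemma path_cost_sub p a b a' b' : lip1 p -> a <= a' -> b' <= b ->
  (path_cost p a' b' <= path_cost p a b)%E.
Proof.
move=> lp aa bb; apply: ge0_subset_integral => //.
- exact: measurable_funS (measurable_rho_path lp).
- by move=> x /=; rewrite !in_itv/= => /andP[h1 h2]; apply/andP; split; lra.
Qed.

Lemma path_cost_shift p a b e : lip1 p ->
  path_cost (fun t => p (t + e)) a b = path_cost p (a + e) (b + e).
Proof.
move=> lp; exact: (@ge0_integral_shift R (rho \o p) e a b
  (measurable_rho_path lp) (fun x => rho0 (p x))).
Qed.

Lemma path_cost_split p a b e : lip1 p -> a <= e -> e <= b ->
  (path_cost p a b <= path_cost p a e + path_cost p e b)%E.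
Proof.
move=> lp ae eb; rewrite /path_cost.
rewrite (@itv_bndbnd_setU _ _ _ (BLeft e))// ?bnd_simp//.
rewrite ge0_integral_setU//=.
- apply: leeD => //; apply: ge0_subset_integral => //.
    exact: measurable_funS (measurable_rho_path lp).
  by move=> x /=; rewrite !in_itv/= => /andP[-> /ltW ->].
- exact: measurable_funS (measurable_rho_path lp).
- apply/disj_set2P/seteqP; split=> // x /= []; rewrite !in_itv/=.
  by move=> /andP[_ xe] /andP[ex _]; have := lt_le_trans xe ex; rewrite ltxx.
Qed.

Lemma linked_le u v c d : (c <= d)%E -> linked u v c -> linked u v d.
Proof.
move=> cd [p [T [gp p0 pT pc]]]; exists p, T; split=> //.
exact: le_trans cd.
Qed.

Lemma linked_sub p T t1 t2 : good_path p T -> 0 <= t1 -> t1 <= t2 -> t2 <= T ->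
  linked (p t1) (p t2) (path_cost p 0 T).
Proof.
move=> [T0 lp pT cE] t10 t12 t2T.
have t1T := le_trans t12 t2T; have t20 := le_trans t10 t12.
exists (fun t => p (t + t1)), (t2 - t1); split; last first.
- rewrite path_cost_shift// add0r subrK.
  exact: path_cost_sub.
- by rewrite subrK.
- by rewrite add0r.
split.
- by rewrite subr_ge0.
- by move=> s t; apply: le_trans (lp _ _) _; rewrite (addrC t) addrKA.
- rewrite path_length_shift add0r subrK.
  have := path_length_subadd p t10 t12.
  have us t := @unit_speed _ p T t lp pT.
  by rewrite (us t1) ?t10// (us t2) ?t20// addeC -leeBlDr.
- apply: (sub_countable _ cE); apply: subset_card_le.
  move=> x [Ex [t /= tt tx]]; split=> //=; exists (t + t1) => //=.
  by move: tt; rewrite !in_itv/= => /andP[h1 h2]; apply/andP; split; lra.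
Qed.

Lemma linked_cat u v w c d : linked u v c -> linked v w d -> linked u w (c + d).
Proof.
move=> [p [T [[T0 lp pT cE] p0 pTv pc]]] [q [S [[S0 lq qS cF] q0 qSw qd]]].
pose r t := if t <= T then p t else q (t - T).
have rT : r T = q 0 by rewrite /r lexx pTv q0.
have r_le t : t <= T -> r t = p t by rewrite /r => ->.
have r_ge t : T <= t -> r t = q (t - T).
  rewrite le_eqVlt => /predU1P[<-|Tt]; first by rewrite rT subrr.
  by rewrite /r leNgt Tt.
have lr : lip1 r.
  move=> s t; wlog st : s t / s <= t.
    have [st|/ltW ts] := leP s t; first exact.
    by rewrite edistC distrC; exact.
  have [tT|/ltW Tt] := leP t T.
    by rewrite !r_le// (le_trans st).
  have [sT|/ltW Ts] := leP s T; last first.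
    by rewrite !r_ge//; apply: le_trans (lq _ _) _; rewrite opprB addrA subrK.
  rewrite (r_le s)// (r_ge t)//.
  apply: le_trans (edist_triangle (p T) _ _) _.
  have := lp s T; have := lq 0 (t - T); rewrite q0 -pTv.
  by rewrite !ler0_norm; lra.
have TTS : T <= T + S by rewrite lerDl.
have rE1 t : 0 <= t <= T -> r t = p t by move=> /andP[_ /r_le].
have rE2 t : T <= t <= T + S -> r t = q (t - T) by move=> /andP[/r_ge].
have cost1 : path_cost r 0 T = path_cost p 0 T.
  by apply: eq_integral => t; rewrite inE/= in_itv/= => /rE1 ->.
have cost2 : path_cost r T (T + S) = path_cost q 0 S.
  have -> : path_cost r T (T + S) = path_cost (fun t => q (t - T)) T (T + S).
    by apply: eq_integral => t; rewrite inE/= in_itv/= => /rE2 ->.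
  by rewrite path_cost_shift// subrr addrAC subrr add0r.
exists r, (T + S); split; last first.
- apply: le_trans (path_cost_split lr T0 TTS) _.
  by rewrite cost1 cost2; exact: leeD.
- by rewrite r_ge// addrAC subrr add0r.
- by rewrite r_le.
split=> //.
- exact: addr_ge0.
- apply: le_trans (path_length_superadd r T0 TTS).
  rewrite (eq_path_length rE1) (eq_path_length rE2) path_length_shift.
  by rewrite subrr addrAC subrr add0r EFinD leeD.
- apply: (@sub_countable _ _ _ ((E `&` p @` `[0, T]) `|` (E `&` q @` `[0, S]))).
    apply: subset_card_le => x [Ex [t /=]]; rewrite in_itv/= => /andP[t0 tTS] rx.
    have [tT|/ltW Tt] := leP t T; [left|right]; split => //=.
    + by exists t; rewrite -?r_le// in_itv/= t0.
    + exists (t - T); rewrite -?r_ge// in_itv/=.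
      by rewrite subr_ge0 Tt lerBlDl.
  exact: countable_setU.
Qed.

Lemma linked_refl u : linked u u 0%E.
Proof.
exists (fun=> u), 0; split=> //.
- split=> //.
  + by move=> s t; rewrite edistxx.
  + by rewrite path_lengthxx.
  + apply: (@sub_countable _ _ _ [set u]) => //; apply: subset_card_le.
    by move=> x [_ [t _ <-]].
- by rewrite /path_cost set_itv1 integral_set1.
Qed.

Lemma linked_curve u v c : linked u v c -> exists g : curve R,
  [/\ cpath g (clo g) = u, cpath g (chi g) = v, rectifiable g, Fsigma E g &
      (line_integral rho g <= c)%E].
Proof.
move=> [p [T [[T0 lp pT cE] p0 pTv pc]]].
have cp : {within `[0, T], continuous p}.
  by apply: continuous_subspaceT; exact: lip1_continuous.
exists (Curve T0 cp); rewrite /Fsigma /rectifiable /line_integral /curve_length/=.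
have us t := @unit_speed _ p T t lp pT.
rewrite us ?T0 ?lexx//; split=> //; first by rewrite ltry.
apply: le_trans pc; rewrite /path_cost /=.
rewrite le_eqVlt; apply/orP; left; apply/eqP; apply: eq_integral => l.
rewrite inE/= in_itv/= => lT; congr rho; rewrite /arclength_param/=.
case: xgetP => [t _ [tT]|/(_ l)[]].
  by rewrite us//= => -[->].
by rewrite /= us// in_itv/=.
Qed.

End good_paths.

Section rectangle_fubini.
Local Open Scope ereal_scope.
Context d1 d2 (T1 : measurableType d1) (T2 : measurableType d2) (R : realType).
Variables (m1 : {sigma_finite_measure set T1 -> \bar R})
          (m2 : {sigma_finite_measure set T2 -> \bar R}).
Variables (f : T1 * T2 -> \bar R) (A : set T1) (B : set T2).
Hypotheses (mf : measurable_fun setT f) (f0 : forall x, 0 <= f x).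
Hypotheses (mA : measurable A) (mB : measurable B).

Let g := f \_ (A `*` B).

Let mg : measurable_fun setT g.
Proof.
apply/(measurable_restrictT _ (measurableX mA mB)).
exact: measurable_funS mf.
Qed.

Let g0 x : 0 <= g x.
Proof. by rewrite /g patchE; case: ifP. Qed.

Lemma measurable_integral_right :
  measurable_fun setT (fun x => \int[m2]_(y in B) f (x, y)).
Proof.
pose h := f \_ (setT `*` B).
have mh : measurable_fun setT h.
  apply/(measurable_restrictT _ (measurableX measurableT mB)).
  exact: measurable_funS mf.
have h0 x : 0 <= h x by rewrite /h patchE; case: ifP.
have -> : (fun x => \int[m2]_(y in B) f (x, y)) = fubini_F m2 h.
  apply/funext => x; rewrite /fubini_F [LHS]integral_mkcond.
  apply: eq_integral => y _; rewrite /h !patchE.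
  by rewrite in_setX/= in_setT.
exact: measurable_fun_fubini_tonelli_F.
Qed.

Lemma integral_setX1 :
  \int[m1 \x m2]_(z in A `*` B) f z = \int[m1]_(x in A) \int[m2]_(y in B) f (x, y).
Proof.
rewrite integral_mkcond fubini_tonelli1// [RHS]integral_mkcond.
apply: eq_integral => x _; rewrite /fubini_F patchE; case: ifPn => xA.
  rewrite [RHS]integral_mkcond; apply: eq_integral => y _.
  by rewrite !patchE in_setX/= xA.
by apply: integral0_eq => y _; rewrite patchE in_setX/= (negbTE xA).
Qed.

Lemma integral_setX2 :
  \int[m1 \x m2]_(z in A `*` B) f z = \int[m2]_(y in B) \int[m1]_(x in A) f (x, y).
Proof.
rewrite integral_mkcond fubini_tonelli2// [RHS]integral_mkcond.
apply: eq_integral => y _; rewrite /fubini_G patchE; case: ifPn => yB.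
  rewrite [RHS]integral_mkcond; apply: eq_integral => x _.
  by rewrite !patchE in_setX/= yB andbT.
by apply: integral0_eq => x _; rewrite patchE in_setX/= (negbTE yB) andbF.
Qed.

End rectangle_fubini.

Lemma measurable_integral_left d1 d2 (T1 : measurableType d1)
    (T2 : measurableType d2) (R : realType)
    (m1 : {sigma_finite_measure set T1 -> \bar R})
    (f : T1 * T2 -> \bar R) (A : set T1) :
  measurable_fun setT f -> (forall x, 0 <= f x)%E -> measurable A ->
  measurable_fun setT (fun y => \int[m1]_(x in A) f (x, y))%E.
Proof.
move=> mf f0 mA.
apply: (@measurable_integral_right _ _ _ _ _ m1 (f \o @unstable.swap _ _)) => //.
  by apply: measurableT_comp => //; exact: measurable_swap.
by move=> x; exact: f0.
Qed.

Section isometric_paths.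
Variables (R : realType) (E : set (R * R)) (rho : R * R -> \bar R).
Hypotheses (mrho : measurable_fun setT rho) (rho0 : forall x, (0 <= rho x)%E).
Local Notation linked := (linked E rho).
Local Notation path_cost := (path_cost rho).
Implicit Types (f : R -> R * R) (u v p q : R * R) (a b : R).

(** f parametrizes a line. Both orders of a and b are covered, so that a side
    of a rectangle can be followed in both directions. *)
Lemma linked_isometry f (x0 x1 a b : R) :
  (forall s t, edist (f s) (f t) = `|s - t|) -> countable (E `&` range f) ->
  x0 <= a <= x1 -> x0 <= b <= x1 -> linked (f a) (f b) (path_cost f x0 x1).
Proof.
move=> fi cE /andP[xa ax] /andP[xb bx].
have lf : lip1 f by move=> s t; rewrite fi.
have good (p : R -> R * R) (T : R) : 0 <= T -> range p `<=` range f ->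
    (forall s t, edist (p s) (p t) = `|s - t|) -> good_path E p T.
  move=> T0 pf pi; split=> //; first by move=> s t; rewrite pi.
    by apply: le_trans (edist_le_path_length p T0); rewrite pi subr0 ger0_norm.
  apply: (sub_countable _ cE); apply: subset_card_le.
  by move=> x [Ex [t _ tx]]; split=> //; apply: pf; exists t.
have [ab|/ltW ba] := leP a b.
  exists (fun t => f (t + a)), (b - a); split.
  - apply: good; rewrite ?subr_ge0//; first by move=> _ [t _ <-]; exists (t + a).
    by move=> s t; rewrite fi; congr `|_|; lra.
  - by rewrite add0r.
  - by rewrite subrK.
  - rewrite path_cost_shift// add0r subrK.
    exact: path_cost_sub.
exists (fun t => f (- (t - a))), (a - b); split.
- apply: good; rewrite ?subr_ge0//.
    by move=> _ [t _ <-]; exists (- (t - a)).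
  by move=> s t; rewrite fi -opprB normrN; congr `|_|; lra.
- by rewrite sub0r opprK.
- by congr f; lra.
- have lfN : lip1 (fun t => f (- t)).
    by move=> s t; rewrite fi -opprB opprK addrC normrN.
  rewrite (path_cost_shift mrho rho0 _ _ (- a) lfN) sub0r addrAC subrr add0r.
  have := @ge0_integral_opp R (rho \o f) (- a) (- b) (measurable_rho_path mrho lf)
    (fun x => rho0 (f x)).
  rewrite /path_cost /= => ->; rewrite !opprK.
  exact: path_cost_sub.
Qed.

Lemma sparse_countable (A : set (R * R)) : sparse E ->
  (forall p q, A p -> A q -> rational_direction p q) -> countable (E `&` A).
Proof.
move=> sE Ard; have [[x [Ex Ax]]|nx] := pselect ((E `&` A) !=set0).
  apply: (sub_countable _ (countable1 x)); apply: subset_card_le.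
  by move=> y [Ey Ay]; apply: sE => //; exact: Ard.
rewrite (_ : _ `&` _ = set0); first exact: countable0.
by apply: contrapT => /eqP/set0P.
Qed.

(** The segment from u to v at unit speed. It is constant when u = v, thanks to
    the convention on division by zero. *)
Definition segment u v (t : R) : R * R :=
  (u.1 + t * ((v.1 - u.1) / edist u v), u.2 + t * ((v.2 - u.2) / edist u v)).

Lemma sparse_segment u v : sparse E -> rational_direction u v ->
  countable (E `&` range (segment u v)).
Proof.
move=> sE [m [n [mn e]]]; apply: sparse_countable => // _ _ [t _ <-] [s _ <-].
exists m, n; split=> //; rewrite /segment/=.
have -> : u.1 + t * ((v.1 - u.1) / edist u v) -
          (u.1 + s * ((v.1 - u.1) / edist u v)) =
          (s - t) / edist u v * (u.1 - v.1) by lra.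
have -> : u.2 + t * ((v.2 - u.2) / edist u v) -
          (u.2 + s * ((v.2 - u.2) / edist u v)) =
          (s - t) / edist u v * (u.2 - v.2) by lra.
by rewrite -!mulrA e.
Qed.

Lemma segment0 u v : segment u v 0 = u.
Proof. by rewrite /segment !mul0r !addr0 -surjective_pairing. Qed.

Lemma segment_isometry u v : 0 < edist u v ->
  forall s t, edist (segment u v s) (segment u v t) = `|s - t|.
Proof.
move=> d0 s t; apply/eqP; rewrite -(@eqrXn2 _ 2)// ?edist_ge0// edist_sqr/=.
rewrite real_normK ?num_real//; apply/eqP.
have := edist_sqr u v; move: d0; set d := edist u v => d0 dE.
have -> : u.1 + s * ((v.1 - u.1) / d) - (u.1 + t * ((v.1 - u.1) / d)) =
  (s - t) * ((v.1 - u.1) / d) by lra.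
have -> : u.2 + s * ((v.2 - u.2) / d) - (u.2 + t * ((v.2 - u.2) / d)) =
  (s - t) * ((v.2 - u.2) / d) by lra.
rewrite !exprMn -mulrDr -mulrDl !exprVn.
have -> : (v.1 - u.1) ^+ 2 + (v.2 - u.2) ^+ 2 = d ^+ 2.
  by rewrite dE -(opprB v.1) -(opprB v.2) !sqrrN.
by rewrite divff ?mulr1// expf_neq0// gt_eqF.
Qed.

Lemma segment1 u v : segment u v (edist u v) = v.
Proof.
rewrite /segment; have [d0|d0] := eqVneq (edist u v) 0.
  have <- : u = v by apply: edist_le0; rewrite d0.
  by rewrite edistxx !mul0r !addr0 -surjective_pairing.
by rewrite !(mulrC (edist u v)) !divfK// !(addrC u.1, addrC u.2) !subrK
  -surjective_pairing.
Qed.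

Lemma linked_segment u v : sparse E -> rational_direction u v ->
  linked u v (path_cost (segment u v) 0 (edist u v)).
Proof.
move=> sE rd; have [d0|d0] := leP (edist u v) 0.
  by rewrite -(edist_le0 d0); apply: linked_le (linked_refl _ _ u); exact: path_cost_ge0.
rewrite -{1}(segment0 u v) -{2}(segment1 u v).
apply: linked_isometry; rewrite ?lexx ?(ltW d0)//.
- exact: segment_isometry.
- exact: sparse_segment.
Qed.

Definition hline (h x : R) : R * R := (x, h).
Definition vline (h x : R) : R * R := (h, x).

Lemma hline_isometry h s t : edist (hline h s) (hline h t) = `|s - t|.
Proof. by rewrite /edist/= subrr expr0n addr0 sqrtr_sqr. Qed.

Lemma vline_isometry h s t : edist (vline h s) (vline h t) = `|s - t|.
Proof. by rewrite /edist/= subrr expr0n add0r sqrtr_sqr. Qed.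

Lemma sparse_hline h : sparse E -> countable (E `&` range (hline h)).
Proof.
move=> sE; apply: sparse_countable => // _ _ [s _ <-] [t _ <-].
by exists 1, 0; rewrite oner_neq0 rmorph0 mulr0 subrr mul0r.
Qed.

Lemma sparse_vline h : sparse E -> countable (E `&` range (vline h)).
Proof.
move=> sE; apply: sparse_countable => // _ _ [s _ <-] [t _ <-].
by exists 0, 1; rewrite oner_neq0 orbT rmorph0 mulr0 subrr mul0r.
Qed.

(** The boundary of the rectangle [a, b] x [c, d]. *)
Definition frame (a b c d : R) p :=
  [/\ a <= p.1 <= b, c <= p.2 <= d &
      [\/ p.1 = a, p.1 = b, p.2 = c | p.2 = d]].

(** Each point of the frame is linked to the corner (a, c) along at most two
    sides, so that two points are linked along at most four. *)
Lemma frame_linked a b c d x0 x1 y0 y1 (e : R) p q : sparse E ->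
  x0 <= a -> b <= x1 -> y0 <= c -> d <= y1 ->
  (path_cost (vline a) y0 y1 <= e%:E)%E -> (path_cost (vline b) y0 y1 <= e%:E)%E ->
  (path_cost (hline c) x0 x1 <= e%:E)%E -> (path_cost (hline d) x0 x1 <= e%:E)%E ->
  frame a b c d p -> frame a b c d q -> linked p q (4 * e)%:E.
Proof.
move=> sE xa bx yc dy ea eb ec ed fp fq.
have e0 : 0 <= e by rewrite -lee_fin (le_trans _ ea)// path_cost_ge0.
have H h s t : (path_cost (hline h) x0 x1 <= e%:E)%E -> x0 <= s <= x1 ->
    x0 <= t <= x1 -> linked (s, h) (t, h) e%:E.
  move=> eh sx tx; apply: linked_le eh _.
  by apply: (linked_isometry (hline_isometry h)) => //; exact: sparse_hline.
have V h s t : (path_cost (vline h) y0 y1 <= e%:E)%E -> y0 <= s <= y1 ->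
    y0 <= t <= y1 -> linked (h, s) (h, t) e%:E.
  move=> eh sx tx; apply: linked_le eh _.
  by apply: (linked_isometry (vline_isometry h)) => //; exact: sparse_vline.
have C1 u v : linked u v e%:E -> linked u v (2 * e)%:E.
  by apply: linked_le; rewrite lee_fin; lra.
have C2 v u w : linked u v e%:E -> linked v w e%:E -> linked u w (2 * e)%:E.
  move=> uv vw; have := linked_cat mrho rho0 uv vw.
  by apply: linked_le; rewrite -EFinD lee_fin; lra.
have corner u : frame a b c d u ->
    linked u (a, c) (2 * e)%:E /\ linked (a, c) u (2 * e)%:E.
  case: u => s t [/=/andP[as_ sb] /andP[ct td]] st.
  have ? : x0 <= s <= x1 by lra.
  have ? : y0 <= t <= y1 by lra.
  have ? : x0 <= a <= x1 by lra.
  have ? : x0 <= b <= x1 by lra.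
  have ? : y0 <= c <= y1 by lra.
  have ? : y0 <= d <= y1 by lra.
  case: st => [->|->|->|->].
  - by split; apply: C1; exact: V.
  - by split; apply: (C2 (b, c)); by [exact: V|exact: H].
  - by split; apply: C1; exact: H.
  - by split; apply: (C2 (a, d)); by [exact: V|exact: H].
have [pA _] := corner p fp; have [_ Aq] := corner q fq.
have := linked_cat mrho rho0 pA Aq.
by apply: linked_le; rewrite -EFinD lee_fin; lra.
Qed.

End isometric_paths.

(** * Square integrals and averages over boxes *)

Section square_integrals.
Local Open Scope ereal_scope.
Context d (T : measurableType d) (R : realType) (m : {measure set T -> \bar R}).
Variable f : T -> \bar R.
Hypotheses (mf : measurable_fun setT f) (f0 : forall x, 0 <= f x).

Lemma measurable_sqre : measurable_fun setT (fun x => f x ^+ 2).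
Proof.
by under eq_fun do rewrite expe2; exact: emeasurable_funM.
Qed.

Lemma ge0_sqre x : 0 <= f x ^+ 2. Proof. exact: expe_ge0. Qed.

(** The integral of the pointwise inequality 2 f <= c f ^ 2 + 1 / c, which also
    holds where f is infinite. *)
Lemma integral_le_sqr (D : set T) (c : R) : (0 < c)%R -> measurable D ->
  2%:E * \int[m]_(x in D) f x <=
  c%:E * \int[m]_(x in D) f x ^+ 2 + c^-1%:E * m D.
Proof.
move=> c0 mD; have c0' : 0 <= c%:E by rewrite lee_fin ltW.
have ci0 : 0 <= c^-1%:E :> \bar R by rewrite lee_fin invr_ge0 ltW.
have m2 : measurable_fun D (fun x => f x ^+ 2).
  exact: measurable_funS measurable_sqre.
have mD1 : measurable_fun D f by exact: measurable_funS mf.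
have f20 x : D x -> 0 <= f x ^+ 2 by move=> _; exact: ge0_sqre.
rewrite -ge0_integralZl// -ge0_integralZl//.
rewrite -integral_cst// -ge0_integralD//.
- apply: ge0_le_integral => //.
  + by move=> x _; rewrite mule_ge0 ?lee_fin.
  + exact: measurable_funeM.
  + by apply: emeasurable_funD => //; exact: measurable_funeM.
  move=> x _; move: (f0 x); case: (f x) => [r| |]//.
    rewrite lee_fin => r0; rewrite -EFin_expe -!EFinM -EFinD lee_fin.
    have := sqr_ge0 (c * r - 1)%R; rewrite -subr_ge0.
    have -> : (c * r ^+ 2 + c^-1 - 2 * r = c^-1 * (c * r - 1) ^+ 2)%R.
      by field; rewrite gt_eqF.
    by move=> h; rewrite mulr_ge0// invr_ge0 ltW.
  by move=> _; rewrite expe2 mulyy !gt0_muley ?lte_fin// addye.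
- by move=> x Dx; rewrite mule_ge0// f20.
- exact: measurable_funeM.
Qed.

(** The Cauchy-Schwarz inequality for f and 1: choose the best c in
    [integral_le_sqr], namely q divided by the integral of f. *)
Lemma sqr_integral_le (D : set T) (q : R) : (0 < q)%R -> measurable D ->
  m D = q%:E ->
  (\int[m]_(x in D) f x) ^+ 2 <= q%:E * \int[m]_(x in D) f x ^+ 2.
Proof.
move=> q0 mD mDq.
have H c (c0 : (0 < c)%R) := @integral_le_sqr D c c0 mD.
have : 0 <= \int[m]_(x in D) f x by exact: integral_ge0.
have : 0 <= \int[m]_(x in D) f x ^+ 2.
  by apply: integral_ge0 => x _; exact: ge0_sqre.
move: H; rewrite mDq.
case: (\int[m]_(x in D) f x ^+ 2) => [G| |]// H; last first.
  by move=> _ _; rewrite gt0_muley ?lte_fin// leey.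
move=> G0; case: (\int[m]_(x in D) f x) H => [F| |]// H F0; last first.
  by have := H 1%R ltr01; rewrite -!EFinM -EFinD gt0_muley ?lte_fin.
rewrite -EFin_expe -EFinM; move: F0 G0; rewrite !lee_fin => F0 G0.
have {}H c : (0 < c)%R -> (2 * F <= c * G + c^-1 * q)%R.
  by move=> /H; rewrite -!EFinM -EFinD lee_fin.
move: F0; rewrite le_eqVlt => /predU1P[<-|F0].
  by rewrite expr0n/= mulr_ge0// ltW.
have := H (q / F)%R (divr_gt0 q0 F0).
have -> : ((q / F)^-1 * q = F)%R by field; rewrite ?gt_eqF.
move=> h.
suff : (F * F <= q / F * G * F)%R by rewrite mulrAC divfK ?gt_eqF// expr2.
by rewrite ler_pM2r//; lra.
Qed.

End square_integrals.

Section plane_measure.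
Variable R : realType.
Local Notation plane := (measurableTypeR R * measurableTypeR R)%type.
(** [leb2], with the sigma-algebra on which the measures of the factors are
    declared; [integral_leb2] compares the two integrals. *)
Definition plane_measure : set plane -> \bar R := (@lebesgue_measure R \x @lebesgue_measure R)%E.
HB.instance Definition _ := Measure.on plane_measure.
Lemma plane_measure_sigma_finite : sigma_finite setT plane_measure.
Proof.
exists (fun n => `[- n%:R, n%:R]%classic `*` `[- n%:R, n%:R]%classic).
  rewrite predeqE => -[x y]; split=> // _.
  pose n := Num.bound (Num.max `|x| `|y|).
  have : Num.max `|x| `|y| < n%:R by apply: archi_boundP; rewrite le_max normr_ge0.
  rewrite gt_max !ltr_norml => /andP[/andP[x1 x2] /andP[y1 y2]].
  by exists n => //; split=> /=; rewrite in_itv/= !ltW.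
move=> n; split; first exact: measurableX.
rewrite /plane_measure product_measure1E//= !lebesgue_measure_itv/= lte_fin.
by case: ifP => _; rewrite ?mule0 ?ltry// -EFinB -EFinM ltry.
Qed.
HB.instance Definition _ := Measure_isSigmaFinite.Build _ _ _ plane_measure plane_measure_sigma_finite.
End plane_measure.

(** The identity transports one sigma-algebra to the other. *)
Lemma integral_leb2 (R : realType) (f : R * R -> \bar R) :
  measurable_fun setT f -> (forall x, 0 <= f x)%E ->
  (\int[@leb2 R]_x f x = \int[@plane_measure R]_x f x)%E.
Proof.
move=> mf f0.
have mid : @measurable_fun _ _ (measurableTypeR R * measurableTypeR R)%type
    (R * R)%type setT id by move=> _ A mA; rewrite setTI.
pose i : (measurableTypeR R * measurableTypeR R)%type -> (R * R)%type := id.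
have -> : @leb2 R = pushforward (@plane_measure R) i by [].
by rewrite ge0_integral_pushforward.
Qed.

Section plane.
Variable R : realType.
Local Notation mu := (@lebesgue_measure R).
Local Notation mu2 := (@plane_measure R).
Implicit Types (f : R * R -> \bar R) (z : R * R).

Lemma measurable_plane_shift z :
  measurable_fun setT (fun x : R * R => x + z).
Proof.
have -> : (fun x : R * R => x + z) = (fun x => (x.1 + z.1, x.2 + z.2)).
  by apply/funext => x.
by apply: measurable_fun_pair; apply: measurable_funD.
Qed.

Lemma plane_fubini f : measurable_fun setT f -> (forall x, 0 <= f x)%E ->
  (\int[mu2]_x f x = \int[mu]_x \int[mu]_y f (x, y))%E.
Proof.
exact: (@fubini_tonelli1 _ _ (measurableTypeR R) (measurableTypeR R) R mu mu f).
Qed.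

Lemma measurable_plane_fubini f : measurable_fun setT f ->
  (forall x, 0 <= f x)%E ->
  measurable_fun setT (fun x => \int[mu]_y f (x, y))%E.
Proof.
exact: (@measurable_fun_fubini_tonelli_F _ _ (measurableTypeR R)
  (measurableTypeR R) R mu f).
Qed.

Lemma ge0_integral_plane_shift f z : measurable_fun setT f ->
  (forall x, 0 <= f x)%E ->
  (\int[mu2]_x f (x + z)%R = \int[mu2]_x f x)%E.
Proof.
move=> mf f0; have mfz := measurableT_comp mf (measurable_plane_shift z).
rewrite (plane_fubini mfz (fun x => f0 _)) (plane_fubini mf f0).
rewrite -(@ge0_integral_shiftT _ (fun x => \int[mu]_y f (x, y))%E z.1); last 2 first.
- exact: measurable_plane_fubini.
- by move=> x; exact: integral_ge0.
apply: eq_integral => x _.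
rewrite -(@ge0_integral_shiftT _ (fun y => f (x + z.1, y)%R) z.2)//.
exact: measurableT_comp.
Qed.

Definition box (a b c d : R) : set (R * R) := `[a, b]%classic `*` `[c, d]%classic.

Lemma measurable_box a b c d : measurable (box a b c d).
Proof. exact: measurableX. Qed.

Lemma measure_box a b c d : a <= b -> c <= d ->
  mu2 (box a b c d) = ((b - a) * (d - c))%:E.
Proof.
move=> ab cd; rewrite /plane_measure product_measure1E//= !lebesgue_measure_itv/= !lte_fin.
have [ab'|ab'] := ltP a b; have [cd'|cd'] := ltP c d; rewrite -?EFinB -?EFinM//.
- have -> : d = c by lra.
  by rewrite subrr !mulr0.
- have -> : b = a by lra.
  by rewrite subrr !mul0r.
- have -> : b = a by lra.
  by rewrite subrr !mul0r.
Qed.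

Lemma box_conv a b c d (x y : R * R) :
  (box a b c d) (x - y) <-> box (y.1 + a) (y.1 + b) (y.2 + c) (y.2 + d) x.
Proof.
rewrite /box /= !in_itv/=.
by split=> -[/andP[h1 h2] /andP[h3 h4]]; split; apply/andP; split; lra.
Qed.

Lemma ge0_integral_box_shift f z a b c d : measurable_fun setT f ->
  (forall x, 0 <= f x)%E ->
  (\int[mu2]_(x in box a b c d) f (z + x)%R =
   \int[mu2]_(x in box (z.1 + a)%R (z.1 + b)%R (z.2 + c)%R (z.2 + d)%R) f x)%E.
Proof.
move=> mf f0; set B := box (z.1 + a) _ _ _.
have mB : measurable B by exact: measurable_box.
rewrite [LHS]integral_mkcond [RHS]integral_mkcond.
rewrite -[RHS](@ge0_integral_plane_shift _ z).
- apply: eq_integral => x _; rewrite !patchE addrC.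
  have <-// : (x \in box a b c d) = (x + z \in B).
  by apply/idP/idP; rewrite !inE /B => h; [apply/box_conv|move/box_conv: h];
    rewrite addrK.
- apply/(measurable_restrictT _ mB); exact: measurable_funS mf.
- by move=> x; rewrite patchE; case: ifP.
Qed.

Variable rho : R * R -> \bar R.
Hypotheses (mrho : measurable_fun setT rho) (rho0 : forall x, (0 <= rho x)%E).

(** The average of rho over x + Q, without the factor that normalizes it. *)
Definition mollify (Q : set (R * R)) x := (\int[mu2]_(z in Q) rho (x + z)%R)%E.

Lemma mollify_ge0 Q x : (0 <= mollify Q x)%E.
Proof. exact: integral_ge0. Qed.

Lemma measurable_plane_add d (T : measurableType d) (g h : T -> R * R) :
  measurable_fun setT g -> measurable_fun setT h ->
  measurable_fun setT (fun t => g t + h t).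
Proof.
move=> mg mh.
have -> : (fun t => g t + h t) =
    (fun t => ((g t).1 + (h t).1, (g t).2 + (h t).2)) by [].
have mf := @measurable_fst _ _ R R; have ms := @measurable_snd _ _ R R.
by apply: measurable_fun_pair; apply: measurable_funD; exact: measurableT_comp.
Qed.

Let mrhoD : measurable_fun setT (fun x : (R * R) * (R * R) => rho (x.1 + x.2)%R).
Proof.
apply: measurableT_comp => //; apply: measurable_plane_add.
  exact: measurable_fst.
exact: measurable_snd.
Qed.

Local Notation plane := (measurableTypeR R * measurableTypeR R)%type.

Lemma measurable_plane_integral (h : (R * R) * (R * R) -> \bar R) Q :
  measurable_fun setT h -> (forall x, 0 <= h x)%E -> measurable Q ->
  measurable_fun setT (fun x => \int[mu2]_(z in Q) h (x, z))%E.
Proof. exact: (@measurable_integral_right _ _ plane plane R mu2 h Q). Qed.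

Lemma plane_integral_swap (h : (R * R) * (R * R) -> \bar R) Q :
  measurable_fun setT h -> (forall x, 0 <= h x)%E -> measurable Q ->
  (\int[mu2]_x \int[mu2]_(z in Q) h (x, z) =
   \int[mu2]_(z in Q) \int[mu2]_x h (x, z))%E.
Proof.
move=> mh h0 mQ.
have <- := @integral_setX1 _ _ plane plane R mu2 mu2 h setT Q mh h0 measurableT mQ.
exact: (@integral_setX2 _ _ plane plane R mu2 mu2 h setT Q mh h0 measurableT mQ).
Qed.

Lemma measurable_mollify Q : measurable Q -> measurable_fun setT (mollify Q).
Proof.
by move=> mQ; exact: (@measurable_plane_integral (fun x => rho (x.1 + x.2)%R)).
Qed.

Lemma integral_mollify_sqr Q (q : R) : 0 < q -> measurable Q -> mu2 Q = q%:E ->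
  (\int[mu2]_x (mollify Q x ^+ 2) <= (q ^+ 2)%:E * \int[mu2]_x (rho x ^+ 2))%E.
Proof.
move=> q0 mQ Qq; pose h (x : (R * R) * (R * R)) := (rho (x.1 + x.2)%R ^+ 2)%E.
have mh : measurable_fun setT h by exact: (measurable_sqre mrhoD).
have h0 x : (0 <= h x)%E by exact: ge0_sqre.
have mr z : measurable_fun setT (fun x => rho (z + x)%R).
  by apply: measurableT_comp => //; apply: measurable_plane_add.
have q0' : (0 <= q%:E)%E by rewrite lee_fin ltW.
apply: (@le_trans _ _ (\int[mu2]_x (q%:E * \int[mu2]_(z in Q) h (x, z)))%E).
  apply: ge0_le_integral => //.
  - by move=> x _; exact/expe_ge0/mollify_ge0.
  - by apply: measurable_sqre; exact: measurable_mollify.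
  - by apply: measurable_funeM; exact: measurable_plane_integral.
  - move=> x _; apply: (@sqr_integral_le _ plane R mu2 (fun z => rho (x + z)%R)) => //; exact: mr.
rewrite ge0_integralZl//; last 2 first.
- exact: measurable_plane_integral.
- by move=> x _; exact: integral_ge0.
rewrite (plane_integral_swap mh h0 mQ).
rewrite (eq_integral (fun=> \int[mu2]_x (rho x ^+ 2))%E); last first.
  move=> z _; rewrite -[RHS](@ge0_integral_plane_shift _ z)//.
  - exact: measurable_sqre.
  - by move=> x; exact: ge0_sqre.
have cstE (c : \bar R) : (\int[mu2]_(z in Q) c = c * q%:E)%E.
  by rewrite -Qq; exact: integral_cst.
rewrite cstE muleC -muleA -EFinM muleC.
by rewrite -expr2.
Qed.

(** If x is close to y, then a slightly larger box around y contains the box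
    around x. This makes the continuity of averages unnecessary. *)
Lemma mollify_box_le a b c d a' b' c' d' (x y : R * R) :
  y.1 + a' <= x.1 + a -> x.1 + b <= y.1 + b' ->
  y.2 + c' <= x.2 + c -> x.2 + d <= y.2 + d' ->
  (mollify (box a b c d) x <= mollify (box a' b' c' d') y)%E.
Proof.
move=> h1 h2 h3 h4; rewrite /mollify !ge0_integral_box_shift//.
apply: ge0_subset_integral => //; try exact: measurable_box.
  exact: measurable_funS mrho.
move=> [s t] []/=; rewrite /box /= !in_itv/= => /andP[s1 s2] /andP[t1 t2].
by split; apply/andP; split; lra.
Qed.

Hypothesis rho2 : (\int[mu2]_x (rho x ^+ 2) < +oo)%E.

(** Absolute continuity of the integral of rho ^ 2, which is almost everywhere
    finite. *)
Lemma sqr_abs_continuous (e : R) : 0 < e -> exists2 v : R, 0 < v &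
  forall A, measurable A -> (mu2 A < v%:E)%E ->
    (\int[mu2]_(x in A) (rho x ^+ 2) < e%:E)%E.
Proof.
move=> e0; pose g x := fine (rho x ^+ 2)%E.
have m2 := measurable_sqre mrho.
have i2 : mu2.-integrable setT (fun x => rho x ^+ 2)%E.
  apply/integrableP; split => //.
  by under eq_integral do rewrite gee0_abs ?ge0_sqre//.
have mg : measurable_fun setT (EFin \o g).
  by apply/measurable_EFinP; exact: measurableT_comp.
have aeg : ae_eq mu2 setT (fun x => rho x ^+ 2)%E (EFin \o g).
  have := integrable_ae measurableT i2.
  by apply: filterS => x /(_ I) xf _; rewrite /g/= fineK.
have g0 x : 0 <= g x by rewrite /g fine_ge0// ge0_sqre.
have gE A : measurable A ->
    (\int[mu2]_(x in A) (rho x ^+ 2) = \int[mu2]_(x in A) (g x)%:E)%E.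
  move=> mA; apply: (@ge0_ae_eq_integral _ plane R mu2 A) => //.
  - exact: measurable_funS m2.
  - exact: measurable_funS mg.
  - by move=> x _; exact: ge0_sqre.
  - by move=> x _; rewrite lee_fin.
  - by apply: filterS aeg => x h _; exact: h.
have ig : mu2.-integrable setT (EFin \o g).
  apply/integrableP; split => //.
  under eq_integral do rewrite gee0_abs ?lee_fin//.
  rewrite -(gE setT)//.
have [v [v0 vP]] := integral_normr_continuous ig e0.
exists v => // A mA Av; have := vP A mA Av.
rewrite gE//.
rewrite -lte_fin fineK.
  by under eq_integral do rewrite ger0_norm//.
rewrite ge0_fin_numE; last by apply: integral_ge0 => x _; rewrite lee_fin.
have /integrableP[_] := ig.
apply: le_lt_trans; apply: ge0_subset_integral => //.
by have /(measurable_int mu2)/= := integrable_abse ig.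
Qed.

End plane.

(** * Rectangles around the end points *)

Section separation.
Variable R : realType.
Implicit Types (F : set (R * R)) (x y p q : R * R).

(** The l^1 distance: of its two terms, one is at least half of any lower bound
    on it. *)
Definition ndist x y : R := `|x.1 - y.1| + `|x.2 - y.2|.

Lemma ndist_le0 x y : ndist x y <= 0 -> x = y.
Proof. by move=> xy; apply: edist_le0; exact: le_trans (edist_le_norm _ _) xy. Qed.

Lemma compact_separated F1 F2 : compact F1 -> compact F2 -> F1 !=set0 ->
  F2 !=set0 -> F1 `&` F2 = set0 ->
  exists2 D : R, 0 < D & forall x y, F1 x -> F2 y -> D <= ndist x y.
Proof.
move=> c1 c2 [x1 F1x1] [x2 F2x2] F12.
pose f (z : (R * R) * (R * R)) := ndist z.1 z.2.
have cf : continuous f.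
  have cz1 : continuous (fun z : (R * R) * (R * R) => z.1).
    by move=> [a b]; exact: cvg_fst.
  have cz2 : continuous (fun z : (R * R) * (R * R) => z.2).
    by move=> [a b]; exact: cvg_snd.
  move=> z.
  have c11 := cvg_comp _ _ (cz1 z) (@continuous_fst R z.1).
  have c12 := cvg_comp _ _ (cz1 z) (@continuous_snd R z.1).
  have c21 := cvg_comp _ _ (cz2 z) (@continuous_fst R z.2).
  have c22 := cvg_comp _ _ (cz2 z) (@continuous_snd R z.2).
  by apply: cvgD; apply: cvg_norm; apply: cvgB.
have [|||[a b] /[!inE] -[/= F1a F2b] abmin] :=
  @compact_EVT_min _ _ f (F1 `*` F2).
- by exists (x1, x2).
- exact: compact_setX.
- exact: continuous_subspaceT.
exists (f (a, b)).
  rewrite ltNge; apply/negP => /ndist_le0 /= ab.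
  suff : set0 a by []; rewrite -F12; split=> //.
  by rewrite ab.
by move=> x y F1x F2y; apply: (abmin (x, y)); rewrite inE.
Qed.

Lemma nondegenerate F p q : F p -> F q -> p <> q ->
  exists2 D : R, 0 < D & forall x, exists2 y, F y & D <= ndist x y.
Proof.
move=> Fp Fq pq; exists (ndist p q / 2).
  rewrite divr_gt0// ltNge; apply/negP => /ndist_le0.
  exact: pq.
move=> x; have [h|h] := leP (ndist p q / 2) (ndist x p); first by exists p.
exists q => //; move: h; rewrite /ndist.
have := ler_normD (p.1 - x.1) (x.1 - q.1); have := ler_normD (p.2 - x.2) (x.2 - q.2).
rewrite !subrKA (distrC p.1 x.1) (distrC p.2 x.2); lra.
Qed.

End separation.

Section frames.
Variable R : realType.
Local Notation mu2 := (@plane_measure R).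
Local Notation mR := (measurableTypeR R).
Implicit Types (F : set (R * R)) (x p q : R * R) (a b c d : R).

(** A continuous function that is negative inside the rectangle, positive
    outside, and vanishes exactly on its frame. *)
Definition gauge a b c d p : R :=
  Num.max (Num.max (a - p.1) (p.1 - b)) (Num.max (c - p.2) (p.2 - d)).

Lemma gauge_frame a b c d p : gauge a b c d p = 0 -> frame a b c d p.
Proof.
rewrite /gauge /frame !maxEle.
by repeat case: ifPn; rewrite -?ltNge => *; split;
  try (by apply/andP; split; lra);
  first [by apply: Or41; lra|by apply: Or42; lra|by apply: Or43; lra|by apply: Or44; lra].
Qed.

Lemma gauge_lt0 a b c d p : a < p.1 -> p.1 < b -> c < p.2 -> p.2 < d ->
  gauge a b c d p < 0.
Proof. by move=> *; rewrite /gauge !gt_max; repeat (apply/andP; split); lra. Qed.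

Lemma gauge_gt0 a b c d p :
  [\/ p.1 < a, b < p.1, p.2 < c | d < p.2] -> 0 < gauge a b c d p.
Proof.
by move=> h; rewrite /gauge !lt_max; case: h => h; rewrite -subr_gt0 in h;
  rewrite h ?orbT.
Qed.

Lemma gauge_continuous a b c d : continuous (gauge a b c d).
Proof.
have c1 x : {for x, continuous (fst : R * R -> R)} := @continuous_fst R x.
have c2 x : {for x, continuous (snd : R * R -> R)} := @continuous_snd R x.
have -> : gauge a b c d = ((fun p => a - p.1) \max (fun p => p.1 - b)) \max
                          ((fun p => c - p.2) \max (fun p => p.2 - d)) by [].
by do 2?apply: max_fun_continuous; move=> x;
  apply: cvgB; by [exact: cvg_cst|exact: c1|exact: c2].
Qed.

Lemma connected_frame F a b c d p q : connected F -> F p -> F q ->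
  gauge a b c d p < 0 -> 0 < gauge a b c d q -> exists2 r, F r & frame a b c d r.
Proof.
move=> cF Fp Fq gp gq.
have : connected (gauge a b c d @` F).
  apply: connected_continuous_connected => //.
  by apply: continuous_subspaceT; exact: gauge_continuous.
move=> /connected_intervalP/(_ (gauge a b c d p) (gauge a b c d q)).
move=> /(_ (imageP _ Fp) (imageP _ Fq) 0); rewrite !ltW//.
by move=> /(_ isT)[r Fr /gauge_frame]; exists r.
Qed.

Lemma path_frame (g : R -> R * R) s t a b c d : continuous g -> s <= t ->
  Num.min (gauge a b c d (g s)) (gauge a b c d (g t)) <= 0 ->
  0 <= Num.max (gauge a b c d (g s)) (gauge a b c d (g t)) ->
  exists2 r, s <= r <= t & frame a b c d (g r).
Proof.
move=> cg st g1 g2.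
have cgg : {within `[s, t], continuous (gauge a b c d \o g)}.
  apply: continuous_subspaceT => x.
  by apply: continuous_comp; [exact: cg|exact: gauge_continuous].
have [|r] := @IVT R _ s t 0 st cgg; first by rewrite g1 g2.
by rewrite in_itv/= => rst /gauge_frame; exists r.
Qed.

Variable rho : R * R -> \bar R.
Hypotheses (mrho : measurable_fun setT rho) (rho0 : forall x, (0 <= rho x)%E).

Lemma exists_vline a0 a1 c0 c1 (e : R) : 0 <= e -> a0 <= a1 ->
  (\int[mu2]_(x in box a0 a1 c0 c1) rho x < (e * (a1 - a0))%:E)%E ->
  exists2 h, a0 <= h <= a1 & (path_cost rho (vline h) c0 c1 <= e%:E)%E.
Proof.
move=> e0 a01.
rewrite [X in (X < _)%E](@integral_setX1 _ _ mR mR R lebesgue_measure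
  lebesgue_measure rho `[a0, a1]%classic `[c0, c1]%classic)//.
move=> lt_e.
have [|||||h] := @exists_le_average R _ mR lebesgue_measure `[a0, a1]%classic
   (fun h => path_cost rho (vline h) c0 c1) e.
- by [].
- exact: (@measurable_integral_right _ _ mR mR R lebesgue_measure rho).
- by move=> x; exact: path_cost_ge0.
- by [].
- apply: (lt_le_trans lt_e); rewrite EFinM/= lebesgue_measure_itv/= lte_fin.
  by case: ltP => // h; rewrite (_ : a1 = a0) ?subrr//; lra.
by rewrite /= in_itv/= => h1 h2; exists h.
Qed.

Lemma exists_hline a0 a1 c0 c1 (e : R) : 0 <= e -> c0 <= c1 ->
  (\int[mu2]_(x in box a0 a1 c0 c1) rho x < (e * (c1 - c0))%:E)%E ->
  exists2 h, c0 <= h <= c1 & (path_cost rho (hline h) a0 a1 <= e%:E)%E.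
Proof.
move=> e0 a01.
rewrite [X in (X < _)%E](@integral_setX2 _ _ mR mR R lebesgue_measure
  lebesgue_measure rho `[a0, a1]%classic `[c0, c1]%classic)//.
move=> lt_e.
have [|||||h] := @exists_le_average R _ mR lebesgue_measure `[c0, c1]%classic
   (fun h => path_cost rho (hline h) a0 a1) e.
- by [].
- exact: (@measurable_integral_left _ _ mR mR R lebesgue_measure rho).
- by move=> x; exact: path_cost_ge0.
- by [].
- apply: (lt_le_trans lt_e); rewrite EFinM/= lebesgue_measure_itv/= lte_fin.
  by case: ltP => // h; rewrite (_ : c1 = c0) ?subrr//; lra.
by rewrite /= in_itv/= => h1 h2; exists h.
Qed.

(** By Fubini, one can choose each side in a strip of width r between the
    squares of half-sides 2 r and 3 r, so that the integral of rho along it is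
    at most its integral over the large square, divided by r. The latter is
    bounded through the Cauchy-Schwarz inequality; the constant 36 is the area
    of the large square for r = 1. *)
Lemma cheap_frame (E : set (R * R)) x (r e : R) : sparse E -> 0 < r -> 0 < e ->
  (\int[mu2]_(z in box (x.1 - 3 * r) (x.1 + 3 * r) (x.2 - 3 * r) (x.2 + 3 * r))
     (rho z ^+ 2) < (e ^+ 2 / 36)%:E)%E ->
  exists a b c d, [/\ x.1 - 3 * r <= a <= x.1 - 2 * r,
    x.1 + 2 * r <= b <= x.1 + 3 * r, x.2 - 3 * r <= c <= x.2 - 2 * r,
    x.2 + 2 * r <= d <= x.2 + 3 * r &
    forall p q, frame a b c d p -> frame a b c d q ->
      linked E rho p q (4 * e)%:E].
Proof.
move=> sE r0 e0; set Q := box _ _ _ _ => Q2.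
have mQ : measurable Q by exact: measurable_box.
have Q1 : (\int[mu2]_(z in Q) rho z < (e * r)%:E)%E.
  (* With this constant, the area term of [integral_le_sqr] equals e * r. *)
  have l0 : 0 < 36 * r / e by rewrite divr_gt0// mulr_gt0.
  have : (2%:E * \int[mu2]_(z in Q) rho z <= (36 * r / e)%:E *
    \int[mu2]_(z in Q) (rho z ^+ 2) + ((36 * r / e)^-1)%:E * mu2 Q)%E.
    exact: (@integral_le_sqr _ _ R mu2 rho mrho rho0 Q _ l0 mQ).
  rewrite measure_box; [|lra|lra].
  have : (0 <= \int[mu2]_(z in Q) rho z)%E by exact: integral_ge0.
  have : (0 <= \int[mu2]_(z in Q) (rho z ^+ 2))%E.
    by apply: integral_ge0 => z _; exact: ge0_sqre.
  move: Q2; case: (\int[mu2]_(z in Q) (rho z ^+ 2))%E => [I2| |]//.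
  rewrite lte_fin => I2e _.
  case: (\int[mu2]_(z in Q) rho z)%E => [I1| |]//; last first.
    by rewrite gt0_muley ?lte_fin.
  move=> _; rewrite -!EFinM -EFinD lee_fin lte_fin.
  have -> : (36 * r / e)^-1 * ((x.1 + 3 * r - (x.1 - 3 * r)) *
      (x.2 + 3 * r - (x.2 - 3 * r))) = e * r by field; rewrite ?gt_eqF//.
  have : 36 * r / e * I2 < e * r.
    rewrite (_ : e * r = 36 * r / e * (e ^+ 2 / 36)); last first.
      by field; rewrite gt_eqF.
    by rewrite ltr_pM2l.
  lra.
have sub a0 a1 c0 c1 : x.1 - 3 * r <= a0 -> a1 <= x.1 + 3 * r ->
    x.2 - 3 * r <= c0 -> c1 <= x.2 + 3 * r ->
    (\int[mu2]_(z in box a0 a1 c0 c1) rho z < (e * r)%:E)%E.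
  move=> h1 h2 h3 h4; apply: le_lt_trans Q1.
  apply: ge0_subset_integral => //; first exact: measurable_box.
    exact: measurable_funS mrho.
  move=> [s t] []/=; rewrite /Q /box/= !in_itv/= => /andP[s1 s2] /andP[t1 t2].
  by split; apply/andP; split; lra.
have [||a ha ea] := @exists_vline (x.1 - 3 * r) (x.1 - 2 * r)
    (x.2 - 3 * r) (x.2 + 3 * r) e (ltW e0); first lra.
  by rewrite (_ : x.1 - 2 * r - (x.1 - 3 * r) = r); [apply: sub; lra|lra].
have [||b hb eb] := @exists_vline (x.1 + 2 * r) (x.1 + 3 * r)
    (x.2 - 3 * r) (x.2 + 3 * r) e (ltW e0); first lra.
  by rewrite (_ : x.1 + 3 * r - (x.1 + 2 * r) = r); [apply: sub; lra|lra].
have [||c hc ec] := @exists_hline (x.1 - 3 * r) (x.1 + 3 * r)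
    (x.2 - 3 * r) (x.2 - 2 * r) e (ltW e0); first lra.
  by rewrite (_ : x.2 - 2 * r - (x.2 - 3 * r) = r); [apply: sub; lra|lra].
have [||d hd ed] := @exists_hline (x.1 - 3 * r) (x.1 + 3 * r)
    (x.2 + 2 * r) (x.2 + 3 * r) e (ltW e0); first lra.
  by rewrite (_ : x.2 + 3 * r - (x.2 + 2 * r) = r); [apply: sub; lra|lra].
exists a, b, c, d; split=> // p q fp fq.
apply: (frame_linked mrho rho0 sE _ _ _ _ ea eb ec ed fp fq).
- by case/andP: ha.
- by case/andP: hb.
- by case/andP: hc.
- by case/andP: hd.
Qed.

End frames.

(** * Curves through a point *)

Section point_modulus.
Variable R : realType.
Local Notation mu := (@lebesgue_measure R).
Local Notation mu2 := (@plane_measure R).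

(** The square of a sum of distinct powers of 2 is comparable with the sum of
    their squares: adding a power 2 ^ n to a sum T <= 2 ^ n increases the square
    by at most 3 * 4 ^ n. *)
Lemma dyadic_sum_sqr (a : nat -> bool) n :
  (\sum_(k < n) 2 ^+ k * (a k)%:R) ^+ 2 <=
  3 * \sum_(k < n) (2 ^+ k) ^+ 2 * (a k)%:R :> R.
Proof.
have T0 m : 0 <= \sum_(k < m) 2 ^+ k * (a k)%:R :> R.
  by apply: sumr_ge0 => k _; rewrite mulr_ge0// exprn_ge0.
have T2 m : \sum_(k < m) 2 ^+ k * (a k)%:R <= 2 ^+ m :> R.
  elim: m => [|m ih]; first by rewrite big_ord0 expr0.
  rewrite big_ord_recr/= exprS; have : 0 <= 2 ^+ m :> R by rewrite exprn_ge0.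
  by move: ih; case: (a m) => /=; lra.
elim: n => [|n ih]; first by rewrite !big_ord0 expr0n mulr0.
rewrite !big_ord_recr/=; have := T0 n; have := T2 n; move: ih.
have : 0 <= 2 ^+ n :> R by rewrite exprn_ge0.
set T := \sum_(k < n) _; set S := \sum_(k < n) _; set c := 2 ^+ n.
case: (a n) => /=; nra.
Qed.

Variables (p : R * R) (d : R).
Hypothesis d0 : 0 < d.

(* The density is the mean over k < n of the indicators of the concentric
   squares Q k, of half-side r k, weighted by 1 / r k. A curve of length at
   least d with an end point at p spends a time at least r k in Q k, so that
   each square contributes at least 1 / n to the length of the curve; and the
   energy is of order 1 / n. *)
Let r k : R := d / 2 ^+ k.

Let r0 k : 0 < r k. Proof. by rewrite divr_gt0// exprn_gt0. Qed.

Let Q k := box (p.1 - r k) (p.1 + r k) (p.2 - r k) (p.2 + r k).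

Let mQ k : measurable (Q k). Proof. exact: measurable_box. Qed.

Let term n k (x : R * R) : \bar R := ((n%:R * r k)^-1 * \1_(Q k) x)%:E.

Let metric n (x : R * R) : \bar R := (\sum_(k < n) term n k x)%E.

Let term0 n k x : (0 <= term n k x)%E.
Proof. by rewrite lee_fin mulr_ge0// invr_ge0 mulr_ge0// ltW. Qed.

Let mterm n k : measurable_fun setT (term n k).
Proof. by apply/measurable_EFinP; apply: measurable_funM => //; exact: (measurable_indic (mQ k)). Qed.

Let mmetric n : measurable_fun setT (metric n).
Proof. by rewrite /metric; apply: emeasurable_sum => k. Qed.

Let Q_ball k x : edist p x <= r k -> Q k x.
Proof.
move=> px; have := le_trans (normr_edist1 _ _) px.
have := le_trans (normr_edist2 _ _) px; rewrite !ler_norml.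
by move=> /andP[? ?] /andP[? ?]; split; rewrite /= in_itv/=; apply/andP; split; lra.
Qed.

Let metric_energy n : (0 < n)%N ->
  (\int[mu2]_x (metric n x ^+ 2) <= (12 / n%:R)%:E)%E.
Proof.
move=> n0; have n0' : 0 < n%:R :> R by rewrite ltr0n.
pose c k : R := 3 * ((n%:R * r k)^-1) ^+ 2.
have c0 k : 0 <= c k by rewrite mulr_ge0// sqr_ge0.
apply: (@le_trans _ _ (\int[mu2]_x \sum_(k < n) (c k * \1_(Q k) x)%:E)%E).
  apply: ge0_le_integral => //.
  - by move=> x _; apply: expe_ge0; exact: sume_ge0.
  - exact: (measurable_sqre (mmetric n)).
  - apply: emeasurable_sum => k; apply/measurable_EFinP; apply: measurable_funM => //.
    exact: (measurable_indic (mQ k)).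
  - move=> x _; rewrite /metric /term !sumEFin -EFin_expe lee_fin.
  have := dyadic_sum_sqr (fun k => x \in Q k) n.
  have ke : 0 <= ((n%:R * d)^-1) ^+ 2 :> R by rewrite sqr_ge0.
  move=> /(ler_wpM2l ke); rewrite -exprMn mulr_sumr mulrCA mulr_sumr mulr_sumr.
  have rE k : (n%:R * r k)^-1 = (n%:R * d)^-1 * 2 ^+ k.
    rewrite /r; have : 2 ^+ k != 0 :> R by rewrite expf_neq0.
    by move=> ?; field; rewrite ?gt_eqF// lt0r_neq0.
  under eq_bigr do rewrite mulrA -rE -indicE.
  move=> /le_trans; apply; rewrite le_eqVlt; apply/orP; left; apply/eqP.
  by apply: eq_bigr => k _; rewrite /c rE indicE exprMn !mulrA.
rewrite ge0_integral_sum//; last 2 first.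
- move=> k; apply/measurable_EFinP; apply: measurable_funM => //.
  exact: (measurable_indic (mQ k)).
- by move=> k x _; rewrite lee_fin mulr_ge0.
rewrite (eq_bigr (fun k : 'I_n => (12 / n%:R ^+ 2)%:E)); last first.
  move=> k _; under eq_integral do rewrite EFinM.
  rewrite ge0_integralZl//; last 2 first.
  - by apply/measurable_EFinP; exact: (measurable_indic (mQ k)).
  - by rewrite lee_fin.
  have -> : (\int[mu2]_x (\1_(Q k) x)%:E = (2 * r k * (2 * r k))%:E)%E.
    transitivity (mu2 (Q k)).
      rewrite integral_indic; [by rewrite setIT|by []|exact: mQ].
    have rk := r0 k; rewrite measure_box; [|lra|lra].
    by congr EFin; ring.
  rewrite -EFinM /c; congr EFin; have := r0 k => rk.
  by field; rewrite ?gt_eqF.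
rewrite sumEFin lee_fin sumr_const card_ord -mulr_natr.
rewrite le_eqVlt; apply/orP; left; apply/eqP.
by field; rewrite gt_eqF.
Qed.

Let metric_length n (s : R -> R * R) (L : R) : (0 < n)%N -> lip1 s -> d <= L ->
  s 0 = p \/ s L = p ->
  (1 <= \int[mu]_(l in `[0%R, L]) metric n (s l))%E.
Proof.
move=> n0 ls dL sp; have n0' : 0 < n%:R :> R by rewrite ltr0n.
have rL k : r k <= L.
  apply: le_trans dL; rewrite /r ler_pdivrMr ?exprn_gt0//.
  by apply: ler_peMr; [exact: ltW|apply: exprn_ege1; rewrite ler1n].
have mts k : measurable_fun setT (term n k \o s).
  by apply: measurableT_comp => //; exact: lip1_measurable.
rewrite /metric ge0_integral_sum//; last first.
  by move=> k; exact: measurable_funS (mts k).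
apply: (@le_trans _ _ (\sum_(k < n) (n%:R^-1)%:E)%E).
  rewrite sumEFin lee_fin sumr_const card_ord -[leRHS]mulr_natr mulVf//.
  by rewrite gt_eqF.
apply: lee_sum => k _.
have [a [a0 aL Qa]] : exists a, [/\ 0 <= a, a + r k <= L &
    forall l, a <= l <= a + r k -> Q k (s l)].
  case: sp => sp; [exists 0|exists (L - r k)]; (split; first by rewrite ?subr_ge0).
  - by rewrite add0r.
  - move=> l /andP[l0 lr]; apply: Q_ball; rewrite -sp.
    by apply: le_trans (ls _ _) _; rewrite sub0r normrN ger0_norm//; lra.
  - by rewrite subrK.
  - move=> l /andP[l0 lr]; apply: Q_ball; rewrite -sp.
    by apply: le_trans (ls _ _) _; rewrite ger0_norm; lra.
apply: (@le_trans _ _ (\int[mu]_(l in `[a, (a + r k)%R]) term n k (s l))%E); last first.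
  apply: ge0_subset_integral => //.
  - exact: measurable_funS (mts k).
  - by move=> x /=; rewrite !in_itv/= => /andP[h1 h2]; apply/andP; split; lra.
rewrite (eq_integral (cst ((n%:R * r k)^-1)%:E)); last first.
  move=> l; rewrite inE/= in_itv/= => /Qa Qs.
  by rewrite /term indicE mem_set// mulr1.
rewrite integral_cst//= lebesgue_measure_itv/= lte_fin ltrDl r0 -EFinB -EFinM lee_fin.
rewrite le_eqVlt; apply/orP; left; apply/eqP; have := r0 k => rk.
by field; rewrite !gt_eqF.
Qed.

Lemma Mod2_point (G : set (curve R)) :
  (forall g, G g -> d <= edist (cpath g (clo g)) (cpath g (chi g)) /\
     (cpath g (clo g) = p \/ cpath g (chi g) = p)) ->
  (Mod2 G <= 0)%E.
Proof.
move=> Gp; apply/lee_addgt0Pr => e e0; rewrite add0e.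
pose n := (Num.bound (12 / e)).+1.
have n12 : 12 / n%:R <= e.
  have h : 0 <= 12 / e by rewrite divr_ge0// ltW.
  have n0 : 0 < n%:R :> R by rewrite ltr0n.
  have : 12 / e < n%:R by apply: lt_trans (archi_boundP h) _; rewrite ltr_nat.
  by rewrite ltr_pdivrMr// => h'; rewrite ler_pdivrMr//; lra.
apply: (@le_trans _ _ (\int[mu2]_x (metric n x ^+ 2))%E); last first.
  by apply: le_trans (metric_energy _) _; rewrite ?lee_fin.
rewrite -integral_leb2; [|exact: (measurable_sqre (mmetric n))|].
  2: by move=> x; apply: expe_ge0; exact: sume_ge0.
apply: ereal_inf_lbound; exists (metric n) => //; split.
- exact: mmetric.
- by move=> x; exact: sume_ge0.
move=> g Gg rg; have [s [ls s0 sL sE]] := arclength_lip1 rg.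
have [dg pg] := Gp g Gg; rewrite /line_integral.
have -> : (\int[mu]_(l in `[0%R, fine (curve_length g)])
      metric n (arclength_param g l) =
    \int[mu]_(l in `[0%R, fine (curve_length g)]) metric n (s l))%E.
  by apply: eq_integral => l; rewrite inE/= in_itv/= => /sE ->.
apply: metric_length => //; last by rewrite s0 sL.
apply: le_trans dg _; rewrite -s0 -sL; apply: le_trans (ls _ _) _.
rewrite sub0r normrN ger0_norm// fine_ge0//.
by rewrite path_length_ge0// clo_le_chi.
Qed.

End point_modulus.

(** * Polygons with rational vertices *)

Section polygons.
Variable R : realType.
Local Notation mu := (@lebesgue_measure R).
Local Notation mu2 := (@plane_measure R).
Local Notation mR := (measurableTypeR R).
Local Notation plane := (measurableTypeR R * measurableTypeR R)%type.
Variables (E : set (R * R)) (rho : R * R -> \bar R).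
Hypotheses (mrho : measurable_fun setT rho) (rho0 : forall x, (0 <= rho x)%E).
Implicit Types (u v z : R * R) (w : nat -> R * R) (s : R -> R * R).

Lemma segment_lip1 u v : lip1 (segment u v).
Proof.
have [d0|d0] := leP (edist u v) 0; last first.
  by move=> s t; rewrite segment_isometry.
move=> s t; have e : edist u v = 0 by apply/eqP; rewrite eq_le d0 edist_ge0.
by rewrite /segment e invr0 !mulr0 !addr0 edistxx.
Qed.

Lemma edistD u v z : edist (u + z) (v + z) = edist u v.
Proof. by rewrite /edist/=; congr (Num.sqrt (_ ^+ 2 + _ ^+ 2)); lra. Qed.

Lemma segmentD u v z t : segment (u + z) (v + z) t = segment u v t + z.
Proof. by rewrite /segment edistD; congr pair; rewrite /=; lra. Qed.

Definition polygon_cost w n z := (\sum_(i < n)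
  path_cost rho (fun t => (segment (w i) (w i.+1) t + z)%R) 0
    (edist (w i) (w i.+1)))%E.

Lemma linked_polygon w n z : sparse E ->
  (forall i, rational_direction (w i) (w i.+1)) ->
  linked E rho (w 0%N + z) (w n + z) (polygon_cost w n z).
Proof.
move=> sE wrat; elim: n => [|n ih].
  by rewrite /polygon_cost big_ord0; exact: linked_refl.
rewrite /polygon_cost big_ord_recr/=; apply: (linked_cat mrho rho0 ih).
have -> : (fun t => segment (w n) (w n.+1) t + z) =
    segment (w n + z) (w n.+1 + z).
  by apply/funext => t; rewrite segmentD.
rewrite -(edistD _ _ z); apply: linked_segment => //.
have [p [q [pq e]]] := wrat n; exists p, q; split=> //=.
have -> : (w n).1 + z.1 - ((w n.+1).1 + z.1) = (w n).1 - (w n.+1).1 by lra.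
by have -> : (w n).2 + z.2 - ((w n.+1).2 + z.2) = (w n).2 - (w n.+1).2 by lra.
Qed.

Let mtrans s : lip1 s ->
  measurable_fun setT (fun x : (R * R) * R => rho (s x.2 + x.1)%R).
Proof.
move=> ls; apply: measurableT_comp => //; apply: measurable_plane_add.
  by apply: measurableT_comp; [exact: lip1_measurable|exact: measurable_snd].
exact: measurable_fst.
Qed.

Lemma measurable_translated_cost s (T : R) : lip1 s ->
  measurable_fun setT (fun z => path_cost rho (fun t => s t + z)%R 0 T).
Proof.
move=> ls.
exact: (@measurable_integral_right _ _ plane mR R mu
  (fun x => rho (s x.2 + x.1)%R) `[0, T]%classic (mtrans ls)
  (fun x => rho0 _) (measurable_itv _)).
Qed.

Lemma measurable_polygon_cost w n : measurable_fun setT (polygon_cost w n).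
Proof.
apply: emeasurable_sum => i; apply: measurable_translated_cost.
exact: segment_lip1.
Qed.

Lemma polygon_cost_ge0 w n z : (0 <= polygon_cost w n z)%E.
Proof. by apply: sume_ge0 => i _; exact: path_cost_ge0. Qed.

Lemma integral_translated_cost s (T : R) Q : lip1 s -> measurable Q ->
  (\int[mu2]_(z in Q) path_cost rho (fun t => s t + z)%R 0 T =
   \int[mu]_(t in `[0%R, T]) mollify rho Q (s t))%E.
Proof.
move=> ls mQ; pose h (x : (R * R) * R) := rho (s x.2 + x.1)%R.
have mh : measurable_fun setT h by exact: mtrans.
have h0 x : (0 <= h x)%E by exact: rho0.
have mI : measurable `[0, T]%classic by exact: measurable_itv.
have e1 := @integral_setX1 _ _ plane mR R mu2 mu h Q `[0, T]%classic mh h0 mQ mI.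
have e2 := @integral_setX2 _ _ plane mR R mu2 mu h Q `[0, T]%classic mh h0 mQ mI.
by rewrite -[LHS]e1 e2.
Qed.

Lemma integral_polygon_cost w n Q : measurable Q ->
  (\int[mu2]_(z in Q) polygon_cost w n z = \sum_(i < n)
   \int[mu]_(t in `[0%R, edist (w i) (w i.+1)])
     mollify rho Q (segment (w i) (w i.+1) t))%E.
Proof.
move=> mQ; rewrite /polygon_cost ge0_integral_sum//.
- by apply: eq_bigr => i _; apply: integral_translated_cost => //; exact: segment_lip1.
- move=> i; apply: measurable_funS (measurable_translated_cost _ _) => //.
  exact: segment_lip1.
- by move=> i z _; exact: path_cost_ge0.
Qed.

(** Every value of f on A is below every value of g on B, so that the infimum
    of g over B separates them. *)
Lemma integral_cross_le (f g : R -> \bar R) (A B : set R) (k : R) :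
  measurable A -> measurable B -> measurable_fun setT f -> measurable_fun setT g ->
  (forall x, 0 <= f x)%E -> (forall x, 0 <= g x)%E -> 0 <= k ->
  (forall x y, A x -> B y -> f x <= g y)%E -> (mu A <= k%:E * mu B)%E ->
  (\int[mu]_(x in A) f x <= k%:E * \int[mu]_(y in B) g y)%E.
Proof.
move=> mA mB mf mg f0 g0 k0 fg AB; pose m := ereal_inf (g @` B).
have m0 : (0 <= m)%E by apply/ereal_infP => _ [t _ <-].
apply: (@le_trans _ _ (m * mu A)%E).
  rewrite -[leRHS]integral_cst//; apply: ge0_le_integral => //.
  - exact: measurable_funS mf.
  - by move=> x Ax; apply/ereal_infP => _ [t Bt <-]; exact: fg.
apply: (@le_trans _ _ (m * (k%:E * mu B))%E); first exact: lee_wpmul2l.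
rewrite muleCA; apply: lee_wpmul2l; first by rewrite lee_fin.
rewrite -[leLHS]integral_cst//; apply: ge0_le_integral => //.
- exact: measurable_funS mg.
- by move=> t Bt; apply: ge_ereal_inf; exists (g t) => //; exists t.
Qed.

Lemma sum_integral_pieces (g : R -> \bar R) (h : R) n : 0 <= h ->
  measurable_fun setT g -> (forall x, 0 <= g x)%E ->
  (\sum_(i < n) \int[mu]_(t in `[(i%:R * h)%R, (i.+1%:R * h)%R[) g t =
   \int[mu]_(t in `[0%R, (n%:R * h)%R[) g t)%E.
Proof.
move=> h0 mg g0; elim: n => [|n ih].
  by rewrite big_ord0 mul0r set_itvco0 integral_set0.
rewrite big_ord_recr/= ih.
rewrite (@itv_bndbnd_setU _ _ (BLeft 0) (BLeft (n%:R * h)) (BLeft (n.+1%:R * h))).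
- rewrite ge0_integral_setU//=.
  + exact: measurable_funS mg.
  + apply/disj_set2P/seteqP; split=> // x /= []; rewrite !in_itv/=.
    by move=> /andP[_ xe] /andP[ex _]; have := lt_le_trans xe ex; rewrite ltxx.
- by rewrite bnd_simp mulr_ge0.
- by rewrite bnd_simp ler_wpM2r// ler_nat.
Qed.

Lemma rational_near (x e : R) : 0 < e -> exists q : rat, `|ratr q - x| <= e.
Proof.
move=> e0; have [|q] := @rat_in_itvoo R (x - e) (x + e); first lra.
by rewrite in_itv/= => /andP[q1 q2]; exists q; rewrite ler_norml; lra.
Qed.

Lemma rational_points_direction (q1 q2 r1 r2 : rat) :
  rational_direction (ratr q1 : R, ratr q2 : R) (ratr r1, ratr r2).
Proof.
have [e1|e1] := eqVneq q1 r1; last first.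
  exists (q1 - r1), (q2 - r2); rewrite subr_eq0 e1; split=> //=.
  by rewrite !rmorphB/= mulrC.
exists 0, 1; rewrite oner_neq0 orbT; split=> //=.
by rewrite e1 subrr mul0r rmorph0 mulr0.
Qed.

(** The curve is cut into pieces of small length h, and the vertices w i are
    rational points very close to the points of subdivision; the edges have
    length at most k h. Every point of an edge is within tau of every point of
    the corresponding piece of s, so that the average of rho over the small box
    at the former is at most its average over the large box at the latter.
    Fubini exchanges the translations z and the parameter of the polygon. *)
Lemma polygon_approximation s (L r k : R) : lip1 s -> 0 < L -> 0 < r ->
  1 < k -> k <= 2 -> let tau := (k - 1) * r / 2 in
  exists w n, [/\ forall i, rational_direction (w i) (w i.+1),
    `|(w 0%N).1 - (s 0).1| < r /\ `|(w 0%N).2 - (s 0).2| < r,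
    `|(w n).1 - (s L).1| < r /\ `|(w n).2 - (s L).2| < r &
    (\int[mu2]_(z in box 0 r 0 r) polygon_cost w n z <=
     k%:E * \int[mu]_(l in `[0%R, L])
       mollify rho (box (- tau) (r + tau) (- tau) (r + tau)) (s l))%E].
Proof.
move=> ls L0 r0 k1 k2 tau.
have tau0 : 0 < tau by rewrite /tau divr_gt0// mulr_gt0//; lra.
have taur : tau < r by rewrite /tau; nra.
pose n := (Num.bound (L * 5 / tau)).+1.
pose h := L / n%:R.
have n0 : 0 < n%:R :> R by rewrite ltr0n.
have h0 : 0 < h by rewrite divr_gt0.
have nh : n%:R * h = L by rewrite /h mulrC divfK// gt_eqF.
have h5 : 5 * h <= tau.
  have : L * 5 / tau < n%:R.
    have hL : 0 <= L * 5 / tau by rewrite ltW// divr_gt0// mulr_gt0//.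
    by apply: lt_trans (archi_boundP hL) _; rewrite ltr_nat.
  rewrite ltr_pdivrMr// /h => hn; rewrite mulrA ler_pdivrMr//.
  lra.
(* Each end point moves an edge by at most 2 * th, and h + 4 * th = k * h. *)
pose th := (k - 1) * h / 4.
have th0 : 0 < th by rewrite /th divr_gt0// mulr_gt0//; lra.
have thh : 4 * th <= h by rewrite /th; nra.
have /choice[q1 q1P] : forall i, exists q : rat, `|ratr q - (s (i%:R * h)).1| <= th.
  by move=> i; exact: rational_near.
have /choice[q2 q2P] : forall i, exists q : rat, `|ratr q - (s (i%:R * h)).2| <= th.
  by move=> i; exact: rational_near.
pose w i : R * R := (ratr (q1 i), ratr (q2 i)).
exists w, n; split.
- by move=> i; exact: rational_points_direction.
- have := q1P 0%N; have := q2P 0%N; rewrite mul0r /w/=.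
  by move=> h2 h1; split; [apply: le_lt_trans h1 _|apply: le_lt_trans h2 _]; lra.
- have := q1P n; have := q2P n; rewrite nh /w/=.
  by move=> h2 h1; split; [apply: le_lt_trans h1 _|apply: le_lt_trans h2 _]; lra.
have wd i : edist (w i) (s (i%:R * h)) <= 2 * th.
  by apply: le_trans (edist_le_norm _ _) _; have := q1P i; have := q2P i;
    rewrite /w/=; lra.
have sd i : edist (s (i%:R * h)) (s (i.+1%:R * h)) <= h.
  apply: le_trans (ls _ _) _.
  have -> : i%:R * h - i.+1%:R * h = - h.
    by rewrite -addn1 natrD mulrDl mul1r; lra.
  by rewrite normrN ger0_norm// ltW.
have wwd i : edist (w i) (w i.+1) <= k * h.
  have := edist_triangle (s (i%:R * h)) (w i) (w i.+1).
  have := edist_triangle (s (i.+1%:R * h)) (s (i%:R * h)) (w i.+1).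
  have := wd i; have := wd i.+1; rewrite (edistC (w i.+1)); have := sd i.
  by rewrite /th; lra.
set Q' := box (- tau) _ _ _; set g := fun l => mollify rho Q' (s l).
have mQ' : measurable Q' by exact: measurable_box.
have mg : measurable_fun setT g.
  by apply: measurableT_comp; [exact: measurable_mollify|exact: lip1_measurable].
have g0 x : (0 <= g x)%E by exact: mollify_ge0.
rewrite integral_polygon_cost; last exact: measurable_box.
apply: (@le_trans _ _ (\sum_(i < n) (k%:E *
    \int[mu]_(t in `[(i%:R * h)%R, (i.+1%:R * h)%R[) g t))%E).
  apply: lee_sum => i _; apply: integral_cross_le => //.
  - apply: measurableT_comp; last exact: lip1_measurable (segment_lip1 _ _).
    by apply: measurable_mollify => //; exact: measurable_box.
  - by move=> x; exact: mollify_ge0.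
  - by lra.
  - move=> t l /=; rewrite !in_itv/= => /andP[t0 td] /andP[l1 l2].
    have e1 : edist (segment (w i) (w i.+1) t) (w i) <= k * h.
      have := segment_lip1 (w i) (w i.+1) t 0; rewrite segment0.
      move=> /le_trans; apply; rewrite subr0 ger0_norm//.
      exact: le_trans (wwd i).
    have e2 : edist (s (i%:R * h)) (s l) <= h.
      apply: le_trans (ls _ _) _; rewrite distrC ger0_norm ?subr_ge0//.
      by move: l2; rewrite -addn1 natrD mulrDl mul1r; lra.
    have e3 : edist (segment (w i) (w i.+1) t) (s l) <= tau.
      have := edist_triangle (w i) (segment (w i) (w i.+1) t) (s l).
      have := edist_triangle (s (i%:R * h)) (w i) (s l).
      by have := wd i; nra.
    have := le_trans (normr_edist1 _ _) e3; have := le_trans (normr_edist2 _ _) e3.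
    rewrite !ler_norml => /andP[? ?] /andP[? ?].
    by apply: mollify_box_le => //; lra.
  - rewrite !lebesgue_measure_itv/= !lte_fin -!EFinB.
    have hh : i%:R * h < i.+1%:R * h by rewrite ltr_pM2r// ltr_nat.
    rewrite hh (_ : i.+1%:R * h - i%:R * h = h); last first.
      by rewrite -addn1 natrD mulrDl mul1r; lra.
    rewrite -EFinM; case: ifP => _; rewrite lee_fin ?subr0//.
    by rewrite mulr_ge0//; lra.
rewrite -ge0_sume_distrr; last by move=> i _; exact: integral_ge0.
rewrite (sum_integral_pieces _ (ltW h0))// nh.
apply: lee_wpmul2l; first by rewrite lee_fin; lra.
apply: ge0_subset_integral => //.
- exact: measurable_funS mg.
- by move=> x /=; rewrite !in_itv/= => /andP[-> /ltW].
Qed.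

End polygons.

(** * Sparse sets are CNED *)

Section main.
Variable R : realType.
Local Notation mu := (@lebesgue_measure R).
Local Notation mu2 := (@plane_measure R).
Implicit Types (E F : set (R * R)) (x y p q : R * R).

Lemma ndist_triangle p x y : ndist x y <= ndist x p + ndist p y.
Proof.
rewrite /ndist; have := ler_normD (x.1 - p.1) (p.1 - y.1).
by have := ler_normD (x.2 - p.2) (p.2 - y.2); rewrite !subrKA; lra.
Qed.

Lemma ndistC x y : ndist x y = ndist y x.
Proof. by rewrite /ndist distrC (distrC x.2). Qed.

Lemma gauge_inside x p (r a b c d : R) :
  a <= x.1 - 2 * r -> x.1 + 2 * r <= b -> c <= x.2 - 2 * r -> x.2 + 2 * r <= d ->
  `|p.1 - x.1| < 2 * r -> `|p.2 - x.2| < 2 * r -> gauge a b c d p < 0.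
Proof. by rewrite !ltr_norml => *; apply: gauge_lt0; lra. Qed.

Lemma gauge_outside x p (r a b c d : R) :
  x.1 - 3 * r <= a -> b <= x.1 + 3 * r -> x.2 - 3 * r <= c -> d <= x.2 + 3 * r ->
  6 * r < ndist x p -> 0 < gauge a b c d p.
Proof.
move=> ha hb hc hd far; apply: gauge_gt0.
have [h1|h1] := ltP p.1 a; first exact: Or41.
have [h2|h2] := ltP b p.1; first exact: Or42.
have [h3|h3] := ltP p.2 c; first exact: Or43.
have [h4|h4] := ltP d p.2; first exact: Or44.
have : `|x.1 - p.1| <= 3 * r by rewrite ler_norml; lra.
have : `|x.2 - p.2| <= 3 * r by rewrite ler_norml; lra.
by move: far; rewrite /ndist; lra.
Qed.

Lemma frame_near x p (r a b c d : R) :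
  x.1 - 3 * r <= a -> b <= x.1 + 3 * r -> x.2 - 3 * r <= c -> d <= x.2 + 3 * r ->
  frame a b c d p -> ndist x p <= 6 * r.
Proof.
move=> ha hb hc hd [/andP[h1 h2] /andP[h3 h4] _].
have : `|x.1 - p.1| <= 3 * r by rewrite ler_norml; lra.
have : `|x.2 - p.2| <= 3 * r by rewrite ler_norml; lra.
by rewrite /ndist; lra.
Qed.

(* The scale r is small compared with the distance from F1 to F2 and with
   their diameters (both measured by D), and such that the frames of size r
   have small rho-length. The factor k tends to 1 in the end. *)
Variables (E F1 F2 : set (R * R)) (rho : R * R -> \bar R) (D e r k : R).
Hypotheses (sE : sparse E) (mrho : measurable_fun setT rho)
  (rho0 : forall x, (0 <= rho x)%E).
Hypothesis rho1 : forall g, (joining F1 F2 `&` Fsigma E) g -> rectifiable g ->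
  (1 <= line_integral rho g)%E.
Hypotheses (c1 : connected F1) (c2 : connected F2).
Hypothesis sep : forall x y, F1 x -> F2 y -> D <= ndist x y.
Hypothesis far1 : forall x, exists2 y, F1 y & D <= ndist x y.
Hypothesis far2 : forall x, exists2 y, F2 y & D <= ndist x y.
Hypotheses (k1 : 1 < k) (k2 : k <= 2) (r0 : 0 < r) (rD : 13 * r <= D) (e0 : 0 < e).
Hypothesis ek : 8 * e + k^-1 < 1.
Hypothesis cheap : forall x, (\int[mu2]_(z in box (x.1 - 3 * r) (x.1 + 3 * r)
  (x.2 - 3 * r) (x.2 + 3 * r)) (rho z ^+ 2) < (e ^+ 2 / 36)%:E)%E.

Let tau := (k - 1) * r / 2.
Let Q' := box (- tau) (r + tau) (- tau) (r + tau).

(** Otherwise a translate of an approximating polygon has rho-length at most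
    1 / k. A part of it, between its first frame and its second one, completed
    by arcs of the two frames, joins F1 to F2 with rho-length less than 1. *)
Lemma mollified_length (s : R -> R * R) (L : R) :
  lip1 s -> 0 < L -> F1 (s 0) -> F2 (s L) ->
  ((r ^+ 2 / k ^+ 2)%:E <= \int[mu]_(l in `[0%R, L]) mollify rho Q' (s l))%E.
Proof.
move=> ls L0 F1s F2s; rewrite leNgt; apply/negP => Jlt.
have [[hk1 hk2] [hr0 hrD] [he0 hek]] :
  [/\ 1 < k /\ k <= 2, 0 < r /\ 13 * r <= D & 0 < e /\ 8 * e + k^-1 < 1] by [].
have k0 : 0 < k by lra.
have [w [n [wrat w0 wn wcost]]] :=
  polygon_approximation mrho rho0 ls L0 r0 k1 k2.
(* The mean over z of the rho-lengths of the translates is less than 1 / k. *)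
have [z [/= z1 z2] zcost] : exists2 z, box 0 r 0 r z &
    (polygon_cost rho w n z <= k^-1%:E)%E.
  apply: (@exists_le_average R _ _ mu2).
  - exact: measurable_box.
  - exact: measurable_polygon_cost.
  - by move=> z; exact: polygon_cost_ge0.
  - by rewrite invr_ge0 ltW.
  apply: le_lt_trans wcost _.
  have -> : (k^-1%:E * mu2 (box 0 r 0 r) = k%:E * (r ^+ 2 / k ^+ 2)%:E)%E.
    rewrite measure_box ?ltW// -!EFinM; congr EFin.
    by field; rewrite gt_eqF.
  by rewrite lte_pmul2l// lte_fin.
have [p [T [gp p0 pT pcost]]] := linked_polygon mrho rho0 n z sE wrat.
have [T0 lp _ _] := gp; have cp := lip1_continuous lp.
move: z1 z2; rewrite !in_itv/= => /andP[z10 z1r] /andP[z20 z2r].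
have near0 : `|(p 0).1 - (s 0).1| < 2 * r /\ `|(p 0).2 - (s 0).2| < 2 * r.
  by rewrite p0/=; move: w0; rewrite !ltr_norml => -[/andP[? ?] /andP[? ?]];
    split; apply/andP; split; lra.
have nearT : `|(p T).1 - (s L).1| < 2 * r /\ `|(p T).2 - (s L).2| < 2 * r.
  by rewrite pT/=; move: wn; rewrite !ltr_norml => -[/andP[? ?] /andP[? ?]];
    split; apply/andP; split; lra.
have Dsep := sep F1s F2s.
have nearT' : ndist (p T) (s L) < 4 * r by case: nearT; rewrite /ndist; lra.
have [a1 [b1 [cc1 [d1 [/andP[ha ha'] /andP[hb hb'] /andP[hc hc'] /andP[hd hd'] lk1]]]]] :=
  cheap_frame mrho rho0 sE r0 e0 (cheap (s 0)).
have [a2 [b2 [cc2 [d2 [/andP[ia ia'] /andP[ib ib'] /andP[ic ic'] /andP[id id'] lk2]]]]] :=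
  cheap_frame mrho rho0 sE r0 e0 (cheap (s L)).
have self x : `|x.1 - x.1| < 2 * r /\ `|x.2 - x.2| < 2 * r.
  by rewrite !subrr normr0 mulr_gt0.
have [t1 /andP[t10 t1T] fr1] : exists2 t, 0 <= t <= T & frame a1 b1 cc1 d1 (p t).
  apply: path_frame => //.
  - rewrite ge_min; apply/orP; left; apply/ltW.
    by apply: (@gauge_inside (s 0) _ r) => //; case: near0.
  - rewrite le_max; apply/orP; right; apply/ltW.
    apply: (@gauge_outside (s 0) _ r) => //.
    by have := ndist_triangle (p T) (s 0) (s L); lra.
have [t2 /andP[t12 t2T] fr2] : exists2 t, t1 <= t <= T & frame a2 b2 cc2 d2 (p t).
  apply: path_frame => //.
  - rewrite ge_min; apply/orP; right; apply/ltW.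
    by apply: (@gauge_inside (s L) _ r) => //; case: nearT.
  - rewrite le_max; apply/orP; left; apply/ltW.
    apply: (@gauge_outside (s L) _ r) => //.
    have := frame_near ha hb' hc hd' fr1.
    have := ndist_triangle (p t1) (s 0) (s L); rewrite (ndistC (p t1)); lra.
have [q1 F1q1 fq1] : exists2 q, F1 q & frame a1 b1 cc1 d1 q.
  have [y F1y Dy] := far1 (s 0).
  apply: (connected_frame c1 F1s F1y).
  - by apply: (@gauge_inside (s 0) _ r) => //; case: (self (s 0)).
  - by apply: (@gauge_outside (s 0) _ r) => //; lra.
have [q2 F2q2 fq2] : exists2 q, F2 q & frame a2 b2 cc2 d2 q.
  have [y F2y Dy] := far2 (s L).
  apply: (connected_frame c2 F2s F2y).
  - by apply: (@gauge_inside (s L) _ r) => //; case: (self (s L)).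
  - by apply: (@gauge_outside (s L) _ r) => //; lra.
have l1 := lk1 _ _ fq1 fr1; have l2 := lk2 _ _ fr2 fq2.
have lm := linked_le (le_trans pcost zcost) (linked_sub mrho rho0 gp t10 t12 t2T).
have := linked_cat mrho rho0 (linked_cat mrho rho0 l1 lm) l2.
move=> /linked_curve[g [g0 gT rg Eg gcost]].
have g12 : (joining F1 F2 `&` Fsigma E) g by split=> //; split; rewrite ?g0 ?gT.
have := le_trans (rho1 g12 rg) gcost; rewrite -!EFinD lee_fin.
lra.
Qed.

(** The factor of the averaged density is given by [mollified_length]. The box
    has side k * r, so that the energy is multiplied by at most
    (k ^ 2 / r ^ 2) ^ 2 * (k * r) ^ 4. *)
Lemma mollified_admissible :
  exists2 rho', admissible (joining F1 F2) rho' &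
    (\int[mu2]_x (rho' x ^+ 2) <= (k ^+ 8)%:E * \int[mu2]_x (rho x ^+ 2))%E.
Proof.
have [[hk1 hk2] [hr0 hrD] [he0 hek]] :
  [/\ 1 < k /\ k <= 2, 0 < r /\ 13 * r <= D & 0 < e /\ 8 * e + k^-1 < 1] by [].
have k0 : 0 < k by lra.
have tau0 : 0 < tau by rewrite divr_gt0// mulr_gt0//; lra.
have mQ' : measurable Q' by exact: measurable_box.
pose c : R := k ^+ 2 / r ^+ 2.
have c0 : 0 < c by rewrite divr_gt0// exprn_gt0.
have c0' : (0 <= c%:E)%E by rewrite lee_fin ltW.
have mM : measurable_fun setT (mollify rho Q') by exact: measurable_mollify.
exists (fun x => c%:E * mollify rho Q' x)%E.
  split.
  - exact: measurable_funeM.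
  - by move=> x; rewrite mule_ge0// mollify_ge0.
  move=> g [F1g F2g] rg; have [s [ls s0 sL sE']] := arclength_lip1 rg.
  rewrite -s0 in F1g; rewrite -sL in F2g.
  set L := fine (curve_length g) in sL sE' F2g *.
  have L0 : 0 < L.
    have L0 : 0 <= L by rewrite fine_ge0// path_length_ge0// clo_le_chi.
    rewrite lt_neqAle L0 andbT; apply/eqP => L0'.
    have := sep F1g F2g; rewrite -L0' /ndist !subrr normr0; lra.
  rewrite /line_integral -/L.
  have -> : (\int[mu]_(l in `[0%R, L]) (c%:E * mollify rho Q' (arclength_param g l)) =
      \int[mu]_(l in `[0%R, L]) (c%:E * mollify rho Q' (s l)))%E.
    by apply: eq_integral => l; rewrite inE/= in_itv/= => /sE' ->.
  rewrite ge0_integralZl//; last 2 first.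
  - apply: (@measurable_funS _ _ _ _ setT) => //.
    by apply: measurableT_comp => //; exact: lip1_measurable.
  - by move=> x _; exact: mollify_ge0.
  apply: le_trans (lee_wpmul2l c0' (mollified_length ls L0 F1g F2g)).
  rewrite -EFinM lee_fin le_eqVlt; apply/orP; left; apply/eqP.
  by rewrite /c; field; rewrite ?gt_eqF.
under eq_integral do rewrite expe2 muleACA -expe2.
have M20 x : (0 <= mollify rho Q' x ^+ 2)%E by apply: expe_ge0; exact: mollify_ge0.
have mM2 := measurable_sqre mM.
have cc0 : (0 <= c%:E * c%:E)%E by rewrite mule_ge0.
rewrite (ge0_integralZl mu2 measurableT mM2 (fun x _ => M20 x) cc0).
have q0 : 0 < (k * r) ^+ 2 by rewrite exprn_gt0// mulr_gt0.
have Qq : mu2 Q' = ((k * r) ^+ 2)%:E.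
  rewrite measure_box; [|lra|lra].
  by congr EFin; rewrite /tau; field.
apply: le_trans (lee_wpmul2l _ (integral_mollify_sqr mrho rho0 q0 mQ' Qq)) _.
  by rewrite mule_ge0.
rewrite muleA -!EFinM le_eqVlt; apply/orP; left; apply/eqP.
by congr (_%:E * _)%E; rewrite /c; field; rewrite ?gt_eqF.
Qed.

End main.

Lemma le_pow8_limit (R : realType) (x : \bar R) (M : R) : 0 <= M ->
  (forall k, 1 < k -> k <= 2 -> (x <= (k ^+ 8 * M)%:E)%E) -> (x <= M%:E)%E.
Proof.
move=> M0 xk; apply/lee_addgt0Pr => e e0.
have M1 : 0 < 256 * (M + 1) by lra.
have [t [t0 t1 tM]] : exists t : R, [/\ 0 < t, t <= 1 & t * (256 * (M + 1)) <= e].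
  exists (Num.min 1 (e / (256 * (M + 1)))); split.
  - by rewrite lt_min ltr01 divr_gt0.
  - by rewrite ge_min lexx.
  - by rewrite -ler_pdivlMr// ge_min lexx orbT.
apply: le_trans (xk (1 + t) _ _) _; [lra|lra|].
(* By convexity, the power lies below its chord on [1, 2]. *)
have bern m : (1 + t) ^+ m <= 1 + (2 ^+ m - 1) * t.
  elim: m => [|m ih]; first by rewrite !expr0 subrr mul0r addr0.
  rewrite !exprS; have : 1 <= 2 ^+ m :> R by rewrite exprn_ege1// ler1n.
  move: ih; set a := (1 + t) ^+ m; set b := 2 ^+ m => ih b1.
  have : (1 + t) * a <= (1 + t) * (1 + (b - 1) * t) by rewrite ler_pM2l//; lra.
  move=> /le_trans; apply.
  have : 0 <= (b - 1) * (t * (1 - t)) by rewrite !mulr_ge0 ?subr_ge0// ltW.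
  lra.
rewrite -EFinD lee_fin.
have := bern 8%N; have -> : 2 ^+ 8 = 256 :> R by rewrite -natrX.
move=> b8; have : (1 + t) ^+ 8 * M <= (1 + (256 - 1) * t) * M by rewrite ler_wpM2r.
nra.
Qed.

(** If F1 or F2 is a point, the left-hand side vanishes. Otherwise
    [mollified_admissible] bounds it by k ^ 8 times the energy of any
    admissible density, for every k > 1. *)
Lemma Mod2_le_sparse (R : realType) (E F1 F2 : set (R * R)) : sparse E ->
  continuum F1 -> continuum F2 -> F1 !=set0 -> F2 !=set0 -> F1 `&` F2 = set0 ->
  (Mod2 (joining F1 F2) <= Mod2 (joining F1 F2 `&` Fsigma E))%E.
Proof.
move=> sE [k1 c1] [k2 c2] n1 n2 F12.
have [D D0 sep] := compact_separated k1 k2 n1 n2 F12.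
have Mod_ge0 G : (0 <= Mod2 G :> \bar R)%E.
  apply/ereal_infP => _ [rho [mrho rho0 _] <-].
  rewrite integral_leb2; [|exact: measurable_sqre|by move=> x; exact: expe_ge0].
  by apply: integral_ge0 => x _; exact: expe_ge0.
have D20 : 0 < D / 2 by rewrite divr_gt0.
have dist12 g : joining F1 F2 g -> D / 2 <= edist (cpath g (clo g)) (cpath g (chi g)).
  move=> [g1 g2]; have := sep _ _ g1 g2; rewrite /ndist.
  have := normr_edist1 (cpath g (clo g)) (cpath g (chi g)).
  by have := normr_edist2 (cpath g (clo g)) (cpath g (chi g)); lra.
have [[p1 [q1 [F1p1 F1q1 pq1]]]|deg1] :=
    pselect (exists p q, [/\ F1 p, F1 q & p <> q]); last first.
  apply: le_trans (Mod_ge0 _); have [p F1p] := n1.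
  apply: (Mod2_point (p := p) D20) => g Gg; split; first exact: dist12.
  left; apply: contrapT => ne; apply: deg1.
  by exists (cpath g (clo g)), p; split=> //; case: Gg.
have [[p2 [q2 [F2p2 F2q2 pq2]]]|deg2] :=
    pselect (exists p q, [/\ F2 p, F2 q & p <> q]); last first.
  apply: le_trans (Mod_ge0 _); have [p F2p] := n2.
  apply: (Mod2_point (p := p) D20) => g Gg; split; first exact: dist12.
  right; apply: contrapT => ne; apply: deg2.
  by exists (cpath g (chi g)), p; split=> //; case: Gg.
have [D1 D10 far1] := nondegenerate F1p1 F1q1 pq1.
have [D2 D20' far2] := nondegenerate F2p2 F2q2 pq2.
pose D' := Num.min D (Num.min D1 D2).
have D'0 : 0 < D' by rewrite !lt_min D0 D10.
have sep' x y : F1 x -> F2 y -> D' <= ndist x y.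
  by move=> F1x F2y; apply: le_trans (sep _ _ F1x F2y); rewrite ge_min lexx.
have far1' x : exists2 y, F1 y & D' <= ndist x y.
  have [y F1y h] := far1 x; exists y => //.
  by apply: le_trans h; rewrite !ge_min lexx orbT.
have far2' x : exists2 y, F2 y & D' <= ndist x y.
  have [y F2y h] := far2 x; exists y => //.
  by apply: le_trans h; rewrite !ge_min lexx !orbT.
apply/ereal_infP => _ [rho [mrho rho0 rho1] <-].
rewrite integral_leb2; [|exact: measurable_sqre|by move=> x; exact: expe_ge0].
have [rhoy|rhoy] := eqVneq (\int[@plane_measure R]_x (rho x ^+ 2))%E +oo%E.
  by rewrite rhoy leey.
have rho2 : (\int[@plane_measure R]_x (rho x ^+ 2) < +oo)%E by rewrite ltey.
have K k : 1 < k -> k <= 2 ->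
    (Mod2 (joining F1 F2) <= (k ^+ 8)%:E * \int[@plane_measure R]_x (rho x ^+ 2))%E.
  move=> k1' k2'; pose e : R := (1 - k^-1) / 16.
  have ki : k^-1 < 1 by rewrite invf_lt1//; lra.
  have e0 : 0 < e by rewrite /e; lra.
  have ek : 8 * e + k^-1 < 1 by rewrite /e; lra.
  have e20 : 0 < e ^+ 2 / 36 by rewrite divr_gt0// exprn_gt0.
  have [v v0 vP] := sqr_abs_continuous mrho rho0 rho2 e20.
  pose r : R := Num.min 1 (Num.min (D' / 13) (v / 37)).
  have r0 : 0 < r by rewrite !lt_min ltr01 !divr_gt0.
  have r1 : r <= 1 by rewrite ge_min lexx.
  have rD : 13 * r <= D'.
    have : r <= D' / 13 by rewrite !ge_min lexx orbT.
    lra.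
  have rv : 37 * r <= v.
    have : r <= v / 37 by rewrite !ge_min lexx !orbT.
    lra.
  have cheap (x : R * R) : (\int[@plane_measure R]_(z in
      box (x.1 - 3 * r) (x.1 + 3 * r) (x.2 - 3 * r) (x.2 + 3 * r)) (rho z ^+ 2) <
      (e ^+ 2 / 36)%:E)%E.
    apply: vP; first exact: measurable_box.
    by rewrite measure_box; [rewrite lte_fin; nra|lra|lra].
  have [rho' [mrho' rho'0 rho'1] rho'2] := mollified_admissible sE mrho rho0 rho1
    c1 c2 sep' far1' far2' k1' k2' r0 rD e0 ek cheap.
  apply: le_trans rho'2; rewrite -integral_leb2.
  - by apply: ereal_inf_lbound; exists rho'.
  - exact: measurable_sqre.
  - by move=> x; exact: expe_ge0.
move: K; have : (0 <= \int[@plane_measure R]_x (rho x ^+ 2))%E.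
  by apply: integral_ge0 => x _; exact: expe_ge0.
move: rhoy; case: (\int[@plane_measure R]_x (rho x ^+ 2))%E => [M| |]// _ M0 K.
exact: le_pow8_limit.
Qed.

Lemma sparse_CNED (R : realType) (E : set (R * R)) : sparse E -> CNED E.
Proof.
move=> sE F1 F2 k1 k2 n1 n2 F12; apply/eqP; rewrite eq_le Mod2_le_sparse//=.
apply/ereal_infP => _ [rho [mrho rho0 rho1] <-].
apply: ereal_inf_lbound; exists rho => //; split=> // g [Gg _].
exact: rho1.
Qed.

Theorem proposition6p9 (R : realType) :
  exists E : set (R * R), ~ leb2_measurable E /\ CNED E.
Proof.
have [E [sE nE]] := sparse_nonnull R.
by exists E; split; [exact: sparse_nonmeasurable|exact: sparse_CNED].
Qed.
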